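(* The enumeration problem All-Closest-String is in $\mathrm{DelayFPT}$.
   Context: Parameterized enumeration: a parameterized enumeration problem with ordering consists of a set of instances $I$, a polynomial-time computable parameterization $\kappa\colon I\to\mathbb N$, a function assigning to each instance $x$ a finite set $\mathrm{Sol}(x)$ of solutions, and an ordering of solutions; in this paper solutions are finite sets and are ordered by non-decreasing cardinality. An enumeration algorithm for such a problem, on every instance $x$, terminates after finitely many steps and outputs exactly the elements of $\mathrm{Sol}(x)$, each exactly once, such that whenever $y,z\in\mathrm{Sol}(x)$ with $|y|<|z|$, $y$ is output before $z$. The problem is in $\mathrm{TotalFPT}$ if it has an enumeration algorithm whose total running time on every instance $x$ is at most $t(\kappa(x))\cdot p(|x|)$ for some computable $t\colon\mathbb N\to\mathbb N$ and polynomial $p$. It is in $\mathrm{DelayFPT}$ if it has an enumeration algorithm such that, for some computable $t$ and polynomial $p$ and every instance $x$, the time from the start to the first output, the time between any two consecutive outputs, and the time from the last output to termination are each at most $t(\kappa(x))\cdot p(|x|)$. Closest string: for a binary string $w=w_1\cdots w_n$ and $S\subseteq\{1,\dots,n\}$, $S(w)$ is the string obtained from $w$ by flipping exactly the bits at positions in $S$. $d_H$ denotes Hamming distance. An instance is $(s_1,\dots,s_k,n,d)$ where $s_1,\dots,s_k\in\{0,1\}^n$ and $d\in\mathbb N$; the parameter is $d$. A solution is a set $S\subseteq\{1,\dots,n\}$ with $d_H(S(s_1),s_i)\le d$ for all $1\le i\le k$; it is minimal if no proper subset of $S$ is a solution. Min-Closest-String: output all minimal solutions ordered by non-decreasing size.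 All-Closest-String: output all solutions ordered by non-decreasing size. *)

(* Defs.v *)
From mathcomp Require Import all_boot.
Set Implicit Arguments. Unset Strict Implicit. Unset Printing Implicit Defensive.

(* Machine model: a deterministic unit-cost RAM (addition, truncated  *)
(* subtraction, indirect addressing, conditional jump) with an output *)
(* facility.  A solution is written element by element with IEmit and *)
(* then released as one output with IFlush (each instruction = 1 step) *)

Inductive instr : Type :=
| IConst (r c : nat)
| IAdd (r a b : nat)
| ISub (r a b : nat)
| ILoad (r a : nat)
| IStore (a r : nat)
| IJmp (l : nat)
| IJz (r l : nat)
| IEmit (r : nat)
| IFlush
| IHalt.

Definition program := seq instr.

Record config := Config { pc : nat; mem : nat -> nat; buf : seq nat }.

Definition upd (m : nat -> nat) (r v : nat) : nat -> nat :=
  fun i => if i == r then v else m i.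

(* One step: None if the machine has halted (IHalt or pc out of range);
   otherwise the next configuration and possibly an emitted output. *)
Definition step (P : program) (c : config) : option (config * option (seq nat)) :=
  let m := mem c in
  let nx := (pc c).+1 in
  match nth IHalt P (pc c) with
  | IConst r k => Some (Config nx (upd m r k) (buf c), None)
  | IAdd r a b => Some (Config nx (upd m r (m a + m b)) (buf c), None)
  | ISub r a b => Some (Config nx (upd m r (m a - m b)) (buf c), None)
  | ILoad r a => Some (Config nx (upd m r (m (m a))) (buf c), None)
  | IStore a r => Some (Config nx (upd m (m a) (m r)) (buf c), None)
  | IJmp l => Some (Config l m (buf c), None)
  | IJz r l => Some (Config (if m r == 0 then l else nx) m (buf c), None)
  | IEmit r => Some (Config nx m (rcons (buf c) (m r)), None)
  | IFlush => Some (Config nx m [::], Some (buf c))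
  | IHalt => None
  end.

Definition halted (P : program) (c : config) : bool :=
  if step P c is None then true else false.

Fixpoint exec (P : program) (c : config) (t : nat) : config :=
  match t with
  | 0 => c
  | t'.+1 => if step P (exec P c t') is Some (c', _) then c' else exec P c t'
  end.

Definition out_at (P : program) (c : config) (t : nat) : option (seq nat) :=
  if step P (exec P c t) is Some (_, o) then o else None.

Definition halts_exactly (P : program) (c : config) (T : nat) : Prop :=
  halted P (exec P c T) /\ forall s, s < T -> ~~ halted P (exec P c s).

Definition outputs (P : program) (c : config) (T : nat) : seq (seq nat) :=
  pmap (out_at P c) (iota 0 T).

Definition init (x : seq nat) : config :=
  Config 0 (fun i => if i == 0 then size x else nth 0 x i.-1) [::].

Definition input_size (x : seq nat) : nat := \sum_(a <- x) (trunc_log 2 a).+1.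

Definition RAM_computable (f : nat -> nat) : Prop :=
  exists Pf : program, forall a, exists T,
    halts_exactly Pf (init [:: a]) T /\ outputs Pf (init [:: a]) T = [:: [:: f a]].

(* Parameterized enumeration problems with solutions = finite sets of *)
(* naturals, each set represented canonically by its strictly        *)
(* increasing list of elements; ordering by non-decreasing size.      *)

Record enum_problem := EnumProblem {
  ep_inst : Type;
  ep_valid : ep_inst -> Prop;
  ep_encode : ep_inst -> seq nat;
  ep_param : ep_inst -> nat;
  ep_sol : ep_inst -> seq nat -> bool
}.

Definition DelayFPT (E : enum_problem) : Prop :=
  exists (P : program) (t : nat -> nat) (c e : nat),
    RAM_computable t /\
    forall x : ep_inst E, ep_valid x ->
      let c0 := init (ep_encode x) in
      let B := t (ep_param x) * (c * (input_size (ep_encode x)) ^ e + c) in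
      exists T, halts_exactly P c0 T /\
        let outs := outputs P c0 T in
        uniq outs /\
        (forall S, S \in outs <-> ep_sol x S) /\
        (forall i j, i < size outs -> j < size outs ->
           size (nth [::] outs i) < size (nth [::] outs j) -> i < j) /\
        (* delay: no stretch of steps without output (before the first,
           between consecutive outputs, after the last until halting)
           is longer than B *)
        (forall a b, a <= b -> b <= T ->
           (forall s, a <= s -> s < b -> out_at P c0 s = None) ->
           b - a <= B).

Record cs_instance := CSInstance {
  cs_strings : seq (seq bool);
  cs_n : nat;
  cs_d : nat
}.

Definition cs_valid (x : cs_instance) : Prop :=
  0 < size (cs_strings x) /\ all (fun s => size s == cs_n x) (cs_strings x).

(* S(w): flip the bits of w at (1-based) positions in S *)
Definition flipS (S : seq nat) (w : seq bool) : seq bool :=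
  [seq (if i.+1 \in S then ~~ nth false w i else nth false w i) | i <- iota 0 (size w)].

Definition hamming (u v : seq bool) : nat :=
  \sum_(i < size u) (nth false u i != nth false v i).

Definition cs_solution (x : cs_instance) (S : seq nat) : bool :=
  [&& sorted ltn S,
      all (fun i => 0 < i <= cs_n x) S &
      all (fun s => hamming (flipS S (head [::] (cs_strings x))) s <= cs_d x)
          (cs_strings x)].

Definition cs_encode (x : cs_instance) : seq nat :=
  [:: size (cs_strings x); cs_n x; cs_d x] ++
  flatten [seq [seq nat_of_bool b | b <- s] | s <- cs_strings x].

Definition AllClosestString : enum_problem :=
  @EnumProblem cs_instance cs_valid cs_encode cs_d cs_solution.

(* Main.v *)
Require Import Defs.
From mathcomp Require Import all_boot zify.
Set Implicit Arguments. Unset Strict Implicit. Unset Printing Implicit Defensive.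

(** A solution [S] has size at most [d], because [s_1] is itself one of the
    strings.  For each size [l = 0, ..., d] in turn, the solutions of size
    exactly [l] are produced by a depth-first search on the characteristic
    vector of [S], position by position; a prefix is abandoned as soon as an
    oracle reports that it does not extend to a solution of size [l].  Every
    prefix kept leads to an output, so the delay is polynomially many oracle
    calls per size.

    The oracle is a bounded search tree.  Let [y] be the current vector and [r]
    the number of positions still to be flipped.  If some string [a] satisfies
    [dist y a + r > d], one of the [r] flips must hit a position where [y] and
    [a] disagree; at most [d + r] positions qualify, so it branches on them.  If
    there is no such string, any [r] free positions will do.  The tree has depth
    at most [d] and its branches are numbered by integers written in base
    [2d + 2], which makes the search a bounded loop.

    The algorithm is written in a small loop language that is compiled to the
    machine.  All loop bounds are read-only variables, which gives the running
    time of a loop-language command from its initial state. *)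

(** * The loop language and its compiler *)

(** The oracle must be exact: a prefix kept in vain would let silence pile up, a prefix dropped
    wrongly would lose outputs. With exactness, silence builds up only along one return and one
    descent, and over consecutive sizes without solutions; there are only [d + 1] sizes.

    Numbering the branches removes the stack of a recursive search. Each branching adds one
    position, so at most [d] digits matter; [2 * d + 2] exceeds [d + r] for every [r <= d], so a
    digit can name any candidate. Trying all [(2 * d + 2) ^ (d + 1)] numbers is the source of the
    factor that depends on the parameter alone.

    The traversal as a whole has no useful bound on its number of rounds. It is therefore not a
    [For] but a machine loop assembled around a compiled body that makes a single move, and silence
    is counted in rounds of that loop.

    The input lies where the compiler keeps its variables, and the machine has no multiplication.
    Hence the hand-written prologue, division by repeated subtraction and powers by repeated
    addition. *)

Definition trace := seq (option (seq nat)).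

Inductive run (P : program) : config -> trace -> config -> Prop :=
| run_nil c : run P c [::] c
| run_cons c o c1 tr c2 :
    step P c = Some (c1, o) -> run P c1 tr c2 -> run P c (o :: tr) c2.

Lemma run_cat P c1 t1 c2 t2 c3 :
  run P c1 t1 c2 -> run P c2 t2 c3 -> run P c1 (t1 ++ t2) c3.
Proof. by move=> H; elim: H c3 t2 => //= c o d tr e Hs _ IH c3 t2 /IH; apply: run_cons. Qed.

Lemma run1 P c o c1 : step P c = Some (c1, o) -> run P c [:: o] c1.
Proof. by move=> H; apply: run_cons H (run_nil _ _). Qed.

Lemma run_exec P c tr c' : run P c tr c' ->
  exec P c (size tr) = c' /\
  forall s, s < size tr ->
    out_at P c s = nth None tr s /\ ~~ halted P (exec P c s).
Proof.
(* [exec] adds steps at the end of an execution, [run] at its front; this equation moves one step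
   across. *)
have shift c1 c2 o s : step P c1 = Some (c2, o) -> exec P c1 s.+1 = exec P c2 s.
  by move=> H; elim: s => [|s IH]; [rewrite /= H | rewrite /= -IH].
elim=> {c tr c'} [c|c o c1 tr c2 Hs _ [IH1 IH2]]; first by [].
split; first by rewrite [size _]/= (shift _ _ _ _ Hs).
case=> [|s] Hlt; first by rewrite /out_at /halted /= Hs.
have [] := IH2 s Hlt; rewrite /out_at /halted (shift _ _ _ _ Hs) /=.
by move=> -> ->.
Qed.

Lemma run_halts P c tr c' : run P c tr c' -> step P c' = None ->
  halts_exactly P c (size tr) /\ outputs P c (size tr) = pmap id tr.
Proof.
move=> H Hn; have [H1 H2] := run_exec H; split.
  split; first by rewrite /halted H1 Hn.
  by move=> s /H2[].
rewrite /outputs.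
have pm (l : seq nat) f : pmap f l = pmap id [seq f i | i <- l] :> seq (seq nat).
  by elim: l => //= a l ->.
rewrite -[in RHS](mkseq_nth None tr) /mkseq pm; congr pmap.
by apply/eq_in_map => s; rewrite mem_iota /= add0n => /H2[].
Qed.

Inductive expr :=
| Cst of nat
| Var of nat
| Plus of expr & expr
| Minus of expr & expr
| Get of expr.

Inductive cmd :=
| Skip
| Asg of nat & expr
| Put of expr & expr
| Seq of cmd & cmd
| If of expr & cmd & cmd
| For of nat & nat & cmd
| Emit of expr
| Flush.

(** Variables and heap are separate maps, so an indirect store can never touch a loop bound. [lg] is
    a ghost log of the released outputs and has no counterpart in memory. *)
Record state := State {
  vs : nat -> nat;
  hp : nat -> nat;
  bf : seq nat;
  lg : seq (seq nat) }.

Definition setv st v x := State (upd (vs st) v x) (hp st) (bf st) (lg st).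

Fixpoint ev st e :=
  match e with
  | Cst c => c
  | Var v => vs st v
  | Plus a b => ev st a + ev st b
  | Minus a b => ev st a - ev st b
  | Get a => hp st (ev st a)
  end.

(** A [For] reads its bound once and leaves its counter equal to it, which is the value at which the
    compiled loop exits. *)
Fixpoint den c st : state :=
  match c with
  | Skip => st
  | Asg v e => setv st v (ev st e)
  | Put a e => State (vs st) (upd (hp st) (ev st a) (ev st e)) (bf st) (lg st)
  | Seq c1 c2 => den c2 (den c1 st)
  | If e c1 c2 => if ev st e == 0 then den c2 st else den c1 st
  | For i v c1 =>
      setv (iteri (vs st v) (fun j s => den c1 (setv s i j)) st) i (vs st v)
  | Emit e => State (vs st) (hp st) (rcons (bf st) (ev st e)) (lg st)
  | Flush => State (vs st) (hp st) [::] (rcons (lg st) (bf st))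
  end.

(* Cells below [nvars] hold the variables, those from [nvars] to [hbase - 1] the
   temporaries of expression evaluation, and cell [h + hbase] holds heap cell [h]. *)
Notation nvars := 32.
Notation hbase := 40.

(** The cells from [t] upwards serve as an evaluation stack, with the result in [t]. The machine has
    no move instruction, so a variable is copied by adding it to 0. *)
Fixpoint ecomp t e : seq instr :=
  match e with
  | Cst c => [:: IConst t c]
  | Var v => [:: IConst t 0; IAdd t t v]
  | Plus a b => ecomp t a ++ ecomp t.+1 b ++ [:: IAdd t t t.+1]
  | Minus a b => ecomp t a ++ ecomp t.+1 b ++ [:: ISub t t t.+1]
  | Get a => ecomp t a ++ [:: IConst t.+1 hbase; IAdd t t t.+1; ILoad t t]
  end.

Fixpoint efit t e :=
  match e with
  | Cst _ => t < hbase
  | Var v => (v < nvars) && (t < hbase)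
  | Plus a b | Minus a b => efit t a && efit t.+1 b
  | Get a => efit t a && (t.+1 < hbase)
  end.

Fixpoint csize c :=
  match c with
  | Skip => 0
  | Asg v e => size (ecomp nvars e) + 2
  | Put a e => size (ecomp nvars a) + 2 + (size (ecomp nvars.+1 e) + 1)
  | Seq c1 c2 => csize c1 + csize c2
  | If e c1 c2 => size (ecomp nvars e) + (csize c1 + csize c2).+2
  | For _ _ c => csize c + 6
  | Emit e => size (ecomp nvars e) + 1
  | Flush => 1
  end.

(** Jumps are absolute, so [p] is the address at which the code will be placed. The back jump of a
    loop goes to [p.+1], behind the reset of the counter. *)
Fixpoint ccomp p c : seq instr :=
  match c with
  | Skip => [::]
  | Asg v e => ecomp nvars e ++ [:: IConst v 0; IAdd v v nvars]
  | Put a e =>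
      ecomp nvars a ++ [:: IConst nvars.+1 hbase; IAdd nvars nvars nvars.+1]
      ++ ecomp nvars.+1 e ++ [:: IStore nvars nvars.+1]
  | Seq c1 c2 => ccomp p c1 ++ ccomp (p + csize c1) c2
  | If e c1 c2 =>
      let s := p + size (ecomp nvars e) in
      let t := s.+1 + csize c1 in
      ecomp nvars e ++ IJz nvars t.+1 :: ccomp s.+1 c1
      ++ IJmp (t.+1 + csize c2) :: ccomp t.+1 c2
  | For i v c =>
      [:: IConst i 0; ISub nvars v i; IJz nvars (p + (csize c + 6))]
      ++ ccomp (p + 3) c ++ [:: IConst nvars 1; IAdd i i nvars; IJmp p.+1]
  | Emit e => ecomp nvars e ++ [:: IEmit nvars]
  | Flush => [:: IFlush]
  end.

Lemma size_ccomp p c : size (ccomp p c) = csize c.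
Proof.
elim: c p => //=.
- by move=> v e p; rewrite size_cat.
- by move=> a e p; rewrite !size_cat /= size_cat /=; lia.
- by move=> c1 IH1 c2 IH2 p; rewrite size_cat IH1 IH2.
- by move=> e c1 IH1 c2 IH2 p; rewrite !size_cat /= size_cat /= IH1 IH2; lia.
- by move=> i v c IH p; rewrite !size_cat IH /=; lia.
- by move=> e p; rewrite size_cat.
Qed.

Fixpoint writes c v :=
  match c with
  | Asg w _ => v == w
  | Seq c1 c2 | If _ c1 c2 => writes c1 v || writes c2 v
  | For i _ c => (v == i) || writes c v
  | _ => false
  end.

(* Loop bounds are confined to the read-only variables [ro]: this makes the
   running time of a command a function of its initial state alone. *)
Fixpoint wf (ro : pred nat) c :=
  match c with
  | Skip | Flush => true
  | Asg v e => [&& efit nvars e, v < nvars & ~~ ro v]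
  | Put a e => efit nvars a && efit nvars.+1 e
  | Seq c1 c2 => wf ro c1 && wf ro c2
  | If e c1 c2 => [&& efit nvars e, wf ro c1 & wf ro c2]
  | For i v c => [&& i < nvars, v < nvars, ro v, ~~ ro i, ~~ writes c i & wf ro c]
  | Emit e => efit nvars e
  end.

(** Both branches of an [If] are charged. A loop pays 5 steps per round besides its body
    (subtraction, test, constant, increment, jump) and 3 steps for the reset and the last test. *)
Fixpoint cb c (rho : nat -> nat) :=
  match c with
  | Seq c1 c2 => cb c1 rho + cb c2 rho
  | If e c1 c2 => size (ecomp nvars e) + (cb c1 rho + cb c2 rho).+2
  | For _ v c => rho v * (cb c rho + 5) + 3
  | _ => csize c
  end.

Lemma den_frame c st v : ~~ writes c v -> vs (den c st) v = vs st v.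
Proof.
elim: c st => //=.
- by move=> w e st; rewrite /upd => /negbTE ->.
- by move=> c1 IH1 c2 IH2 st; rewrite negb_or => /andP[H1 H2]; rewrite IH2 ?IH1.
- by move=> e c1 IH1 c2 IH2 st; rewrite negb_or => /andP[H1 H2]; case: ifP; rewrite ?IH2 ?IH1.
- move=> i w c IH st; rewrite negb_or /upd => /andP[/negbTE Hi Hc]; rewrite Hi.
  by elim: (vs st w) => //= m IHm; rewrite IH //= /upd Hi.
Qed.

Lemma wf_ro ro c v : wf ro c -> ro v -> ~~ writes c v.
Proof.
move=> + Hr; elim: c => //=.
- by move=> w e /and3P[_ _ H]; apply: contra H => /eqP <-.
- by move=> c1 IH1 c2 IH2 /andP[/IH1 H1 /IH2 H2]; rewrite negb_or H1.
- by move=> e c1 IH1 c2 IH2 /and3P[_ /IH1 H1 /IH2 H2]; rewrite negb_or H1.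
- move=> i w c IH /and5P[_ _ _ Hi /andP[_ /IH H]].
  by rewrite negb_or H andbT; apply: contra Hi => /eqP <-.
Qed.

Lemma cb_ext ro c r1 r2 : wf ro c -> (forall v, ro v -> r1 v = r2 v) ->
  cb c r1 = cb c r2.
Proof.
move=> + H; elim: c => //=.
- by move=> c1 IH1 c2 IH2 /andP[/IH1 -> /IH2 ->].
- by move=> e c1 IH1 c2 IH2 /and3P[_ /IH1 -> /IH2 ->].
- by move=> i w c IH /and5P[_ _ /H -> _ /andP[_ /IH ->]].
Qed.

(** * Correctness and running time of compiled code *)

Definition rep (m : nat -> nat) st :=
  (forall v, v < nvars -> m v = vs st v) /\ (forall h, m (h + hbase) = hp st h).

Fixpoint codeat (P : program) p (c : seq instr) : Prop :=
  if c is i :: c' then nth IHalt P p = i /\ codeat P p.+1 c' else True.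

Lemma codeat_cat P p c1 c2 :
  codeat P p (c1 ++ c2) <-> codeat P p c1 /\ codeat P (p + size c1) c2.
Proof.
elim: c1 p => [|i c IH] p /=; first by rewrite addn0; tauto.
by rewrite IH addSnnS; tauto.
Qed.

Lemma codeat_self a c b : codeat (a ++ c ++ b) (size a) c.
Proof.
elim: c a => //= i c IH a; split; first by rewrite nth_cat ltnn subnn.
by have := IH (rcons a i); rewrite size_rcons cat_rcons.
Qed.

Lemma rep_temp m st t x : nvars <= t < hbase -> rep m st -> rep (upd m t x) st.
Proof.
move=> Ht [H1 H2]; split=> [v Hv|h]; rewrite /upd.
- by case: eqP => [E|_]; [lia | exact: H1].
- by case: eqP => [E|_]; [lia | exact: H2].
Qed.

Lemma rep_setv m st v x : v < nvars -> rep m st -> rep (upd m v x) (setv st v x).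
Proof.
move=> Hv [H1 H2]; split=> [w Hw|h] /=; rewrite /upd.
- by case: eqP => // _; exact: H1.
- by case: eqP => [E|_]; [lia | exact: H2].
Qed.

Lemma upd_eq m r v : upd m r v r = v.
Proof. by rewrite /upd eqxx. Qed.

Lemma upd_neq m r v i : i != r -> upd m r v i = m i.
Proof. by rewrite /upd => /negbTE ->. Qed.

Lemma efit_lt t e : efit t e -> t < hbase.
Proof. by elim: e t => //= [? t /andP[]|a Ha b _ t /andP[/Ha]|a Ha b _ t /andP[/Ha]|a Ha t /andP[/Ha]]. Qed.

(** The clause on cells below [t] is what keeps the left operand, stored in [t], intact while the
    right one is evaluated at [t.+1]. *)
Lemma ecomp_run P p t e m st b :
  codeat P p (ecomp t e) -> efit t e -> nvars <= t -> rep m st ->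
  exists m', [/\ run P (Config p m b) (nseq (size (ecomp t e)) None)
                   (Config (p + size (ecomp t e)) m' b),
    rep m' st, m' t = ev st e & forall u, u < t -> m' u = m u].
Proof.
(* Addition and subtraction are compiled alike and are treated together: [op] is the instruction and
   [F] its meaning. *)
have bin op (F : nat -> nat -> nat) : (forall P p m b r x y, nth IHalt P p = op r x y ->
      step P (Config p m b) = Some (Config p.+1 (upd m r (F (m x) (m y))) b, None)) ->
    forall e1 e2,
    (forall p t m, codeat P p (ecomp t e1) -> efit t e1 -> nvars <= t -> rep m st ->
      exists m', [/\ run P (Config p m b) (nseq (size (ecomp t e1)) None)
                   (Config (p + size (ecomp t e1)) m' b),
       rep m' st, m' t = ev st e1 & forall u, u < t -> m' u = m u]) ->
    (forall p t m, codeat P p (ecomp t e2) -> efit t e2 -> nvars <= t -> rep m st ->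
      exists m', [/\ run P (Config p m b) (nseq (size (ecomp t e2)) None)
                   (Config (p + size (ecomp t e2)) m' b),
       rep m' st, m' t = ev st e2 & forall u, u < t -> m' u = m u]) ->
    forall p t m, codeat P p (ecomp t e1 ++ ecomp t.+1 e2 ++ [:: op t t t.+1]) ->
    efit t e1 && efit t.+1 e2 -> nvars <= t -> rep m st ->
    exists m', [/\ run P (Config p m b) (nseq (size (ecomp t e1 ++ ecomp t.+1 e2 ++ [:: op t t t.+1])) None)
                   (Config (p + size (ecomp t e1 ++ ecomp t.+1 e2 ++ [:: op t t t.+1])) m' b),
       rep m' st, m' t = F (ev st e1) (ev st e2) & forall u, u < t -> m' u = m u].
  move=> Hop e1 e2 IH1 IH2 {}p {}t {}m /codeat_cat[C1 /codeat_cat[C2 /= [C3 _]]] /andP[F1 F2] Ht Hr.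
  have [m1 [R1 S1 V1 U1]] := IH1 _ _ _ C1 F1 Ht Hr.
  have [m2 [R2 S2 V2 U2]] := IH2 _ _ _ C2 F2 (leqW Ht) S1.
  have := efit_lt F1 => Hlt.
  exists (upd m2 t (F (m2 t) (m2 t.+1))); split.
  - rewrite !size_cat !nseqD !addnA /=; apply: run_cat R1 (run_cat R2 _).
    by rewrite addn1; apply: run1; exact: Hop.
  - by apply: rep_temp => //; rewrite Ht Hlt.
  - by rewrite upd_eq U2 // V1 V2.
  - by move=> u Hu; rewrite upd_neq ?neq_ltn ?Hu // U2 ?U1 //; lia.
elim: e p t m => [c|v|e1 IH1 e2 IH2|e1 IH1 e2 IH2|e IH] p t m.
- move=> /= [C _] Ht Hv Hr; exists (upd m t c); split; rewrite ?upd_eq //.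
  + by rewrite addn1; apply: run1; rewrite /step /= C.
  + by apply: rep_temp => //; rewrite Hv.
  + by move=> u Hu; rewrite upd_neq // neq_ltn Hu.
- move=> /= [C [C2 _]] /andP[Hvv Ht] Hv Hr.
  exists (upd (upd m t 0) t (vs st v)); split; rewrite ?upd_eq //.
  + rewrite addn2; apply: run_cons; first by rewrite /step /= C.
    apply: run1; rewrite /step /= C2 /= upd_eq upd_neq ?(proj1 Hr) ?add0n //; lia.
  + by do 2 (apply: rep_temp; rewrite ?Hv //).
  + by move=> u Hu; rewrite !upd_neq // neq_ltn Hu.
- by apply: (bin (fun r x y => IAdd r x y) addn) => //= P' p' m' b' r x y H; rewrite /step /= H.
- by apply: (bin (fun r x y => ISub r x y) subn) => //= P' p' m' b' r x y H; rewrite /step /= H.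
- move=> /= /codeat_cat[C1 /= [C2 [C3 [C4 _]]]] /andP[F1 F2] Ht Hr.
  have [m1 [R1 S1 V1 U1]] := IH _ _ _ C1 F1 Ht Hr.
  have N1 : t != t.+1 by lia.
  pose m2 := upd m1 t.+1 hbase; pose m3 := upd m2 t (ev st e + hbase).
  exists (upd m3 t (m3 (m3 t))); split.
  + rewrite size_cat nseqD /= addnA; apply: run_cat R1 _.
    apply: run_cons; first by rewrite /step /= C2.
    apply: run_cons.
      by rewrite /step /= C3 /= upd_eq upd_neq // V1.
    by apply: run1; rewrite /step /= C4 /= addn3 V1.
  + by rewrite /m3 /m2; do 3 (apply: rep_temp; first by lia).
  + rewrite upd_eq {2}/m3 upd_eq /m3 upd_neq; last lia.
    by rewrite /m2 upd_neq ?(proj2 S1) //; lia.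
  + by move=> u Hu; rewrite /m3 /m2 !upd_neq ?U1 //; lia.
Qed.

Lemma pmap_id_nseq n : pmap id (nseq n (None : option (seq nat))) = [::].
Proof. by elim: n. Qed.

Lemma run_none P c n c' o (c2 : config) :
  run P c (nseq n None) c' -> step P c' = Some (c2, o) ->
  run P c (rcons (nseq n None) o) c2.
Proof. by rewrite -cats1 => H1 H2; apply: run_cat H1 (run1 H2). Qed.

Lemma ccomp_run P ro p c m st :
  codeat P p (ccomp p c) -> wf ro c -> rep m st ->
  exists tr m', [/\ run P (Config p m (bf st)) tr (Config (p + csize c) m' (bf (den c st))),
    rep m' (den c st), lg (den c st) = lg st ++ pmap id tr & size tr <= cb c (vs st)].
Proof.
elim: c p m st => [|v e|a e|c1 IH1 c2 IH2|e c1 IH1 c2 IH2|i v c IH|e|] p m st /=.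
- move=> _ _ Hr; exists [::], m; split=> //=; last by rewrite cats0.
  by rewrite addn0; apply: run_nil.
- move=> /codeat_cat[C1 /= [C2 [C3 _]]] /and3P[Fe Hv _] Hr.
  have [m1 [R1 S1 V1 U1]] := ecomp_run (bf st) C1 Fe (leqnn _) Hr.
  exists (nseq (size (ecomp nvars e)) None ++ [:: None; None]),
    (upd (upd m1 v 0) v (ev st e)); split.
  + rewrite addnA addn2; apply: run_cat R1 _; apply: run_cons; first by rewrite /step /= C2.
    apply: run1; rewrite /step /= C3 /= upd_eq upd_neq ?V1 ?add0n //; lia.
  + suff: rep (upd (upd m1 v 0) v (ev st e)) (setv (setv st v 0) v (ev st e)).
      by case=> H1 H2; split=> // w Hw; rewrite H1 //= /upd; case: eqP.
    by do 2 apply: rep_setv => //.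
  + by rewrite pmap_cat pmap_id_nseq /= cats0.
  + by rewrite size_cat size_nseq.
- move=> /codeat_cat[C1 /= [C2 [C3 /codeat_cat[C4 /= [C5 _]]]]] /andP[Fa Fe] Hr.
  have [m1 [R1 S1 V1 U1]] := ecomp_run (bf st) C1 Fa (leqnn _) Hr.
  pose m2 := upd (upd m1 nvars.+1 hbase) nvars (ev st a + hbase).
  have S2 : rep m2 st by do 2 (apply: rep_temp => //).
  have [m3 [R3 S3 V3 U3]] := ecomp_run (bf st) C4 Fe (leqnSn _) S2.
  have E3 : m3 nvars = ev st a + hbase by rewrite U3 // /m2 upd_eq.
  exists (nseq (size (ecomp nvars a)) None ++ [:: None; None]
          ++ rcons (nseq (size (ecomp nvars.+1 e)) None) None),
    (upd m3 (m3 nvars) (m3 nvars.+1)); split.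
  + apply: run_cat R1 _; apply: run_cons; first by rewrite /step /= C2.
    have St : step P (Config (p + size (ecomp nvars a)).+1 (upd m1 nvars.+1 hbase) (bf st)) =
        Some (Config (p + size (ecomp nvars a)).+2 m2 (bf st), None).
      by rewrite /step /= C3 /= upd_eq upd_neq // V1.
    apply: run_cons St (run_none R3 _).
    by rewrite /step /= C5 /=; congr (Some (Config _ _ _, _)); lia.
  + case: S3 => H1 H2; rewrite E3 V3; split=> /= [w Hw|h]; rewrite /upd.
      by case: eqP => [E|_]; [lia | exact: H1].
    by rewrite eqn_add2r H2.
  + by rewrite !pmap_cat pmap_id_nseq -cats1 pmap_cat pmap_id_nseq /= cats0.
  + by rewrite !size_cat size_rcons !size_nseq /=; lia.
- move=> /codeat_cat[C1 C2] /andP[W1 W2] Hr; rewrite size_ccomp in C2.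
  have [t1 [m1 [R1 S1 L1 B1]]] := IH1 _ _ _ C1 W1 Hr.
  have [t2 [m2 [R2 S2 L2 B2]]] := IH2 _ _ _ C2 W2 S1.
  exists (t1 ++ t2), m2; split=> //.
  + by rewrite addnA; apply: run_cat R1 R2.
  + by rewrite L2 L1 pmap_cat catA.
  + rewrite size_cat leq_add //; apply: leq_trans B2 _.
    (* The second command starts from a later state, but its cost depends only on read-only
       variables, which the first command leaves alone. *)
    rewrite (cb_ext W2 (r2 := vs st)) // => v Hv.
    by apply: den_frame; apply: wf_ro W1 Hv.
- move=> /codeat_cat[C1 /= [C2 /codeat_cat[C3 /= [C4 C5]]]] /and3P[Fe W1 W2] Hr.
  rewrite size_ccomp in C4 C5.
  have [m1 [R1 S1 V1 U1]] := ecomp_run (bf st) C1 Fe (leqnn _) Hr.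
  have St : step P (Config (p + size (ecomp nvars e)) m1 (bf st)) =
      Some (Config (if ev st e == 0 then ((p + size (ecomp nvars e)).+1 + csize c1).+1
                    else (p + size (ecomp nvars e)).+1) m1 (bf st), None).
    by rewrite /step /= C2 V1.
  have {}R1 := run_none R1 St; case: ifP R1 => He R1.
  + have [t2 [m2 [R2 S2 L2 B2]]] := IH2 _ _ _ C5 W2 S1.
    exists (rcons (nseq (size (ecomp nvars e)) None) None ++ t2), m2; split=> //.
    * apply: run_cat R1 _; move: R2; congr (run _ _ _ (Config _ _ _)); lia.
    * by rewrite L2 -cats1 !pmap_cat pmap_id_nseq.
    * by rewrite size_cat size_rcons size_nseq; lia.
  + have [t2 [m2 [R2 S2 L2 B2]]] := IH1 _ _ _ C3 W1 S1.
    exists (rcons (nseq (size (ecomp nvars e)) None) None ++ t2 ++ [:: None]), m2; split=> //.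
    * apply: run_cat R1 (run_cat R2 (run1 _)); rewrite /step /= C4.
      by congr (Some (Config _ _ _, _)); lia.
    * by rewrite L2 -cats1 !pmap_cat pmap_id_nseq /= cats0.
    * by rewrite !size_cat size_rcons size_nseq /=; lia.
- move=> [C1 [C2 [C3 /codeat_cat[C4 /= [C5 [C6 [C7 _]]]]]]].
  rewrite size_ccomp in C5 C6 C7.
  move=> /and5P[Hi Hv rv ri /andP[Wi Wc]] Hr.
  set body := fun j s => den c (setv s i j).
  set b := vs st v.
  have vi : v != i by apply: contraNneq ri => <-.
  have body_ro w j : ro w -> vs (iteri j body st) w = vs st w.
    move=> Hw; elim: j => //= j IHj; rewrite den_frame ?(wf_ro Wc) //= /upd.
    by case: eqP => // E; rewrite -E Hw in ri.
  have bodyi j s : vs (body j s) i = j by rewrite den_frame //= upd_eq.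
  (* Invariant at the loop test, address [p.+1], after [j] rounds; the extra step is the reset of
     the counter. *)
  have key j : j <= b -> exists tr m', [/\
      run P (Config p m (bf st)) tr (Config p.+1 m' (bf (iteri j body st))),
      rep m' (setv (iteri j body st) i j),
      lg (iteri j body st) = lg st ++ pmap id tr &
      size tr <= j * (cb c (vs st) + 5) + 1].
    elim: j => [|j IHj] Hj.
      exists [:: None], (upd m i 0); split=> //=.
      + by apply: run1; rewrite /step /= C1.
      + exact: rep_setv.
      + by rewrite cats0.
    have [tr [m1 [R1 S1 L1 B1]]] := IHj (ltnW Hj).
    set s := iteri j body st in R1 S1 L1.
    have E1 : m1 v - m1 i = b - j.
      rewrite !(proj1 S1) //= upd_eq upd_neq //; congr (_ - _); exact: body_ro.
    have S2 : rep (upd m1 nvars (b - j)) (setv s i j) by apply: rep_temp.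
    have C4' : codeat P (p + 3) (ccomp (p + 3) c) by move: C4; rewrite addn3.
    have [t2 [m2 [R2 S3 L3 B3]]] := IH _ _ _ C4' Wc S2.
    exists (tr ++ [:: None; None] ++ t2 ++ [:: None; None; None]),
      (upd (upd m2 nvars 1) i j.+1); split.
    + apply: run_cat R1 _.
      apply: run_cons; first by rewrite /step /= C2 E1.
      apply: run_cons.
        rewrite /step /= C3 upd_eq subn_eq0 leqNgt Hj /=.
        by rewrite -addn3.
      apply: run_cat R2 _.
      have {}C5 : nth IHalt P (p + 3 + csize c) = IConst nvars 1 by rewrite addn3.
      have {}C6 : nth IHalt P (p + 3 + csize c).+1 = IAdd i i nvars by rewrite addn3.
      have {}C7 : nth IHalt P (p + 3 + csize c).+2 = IJmp p.+1 by rewrite addn3.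
      apply: run_cons; first by rewrite /step /= C5.
      apply: run_cons; first by rewrite /step /= C6.
      rewrite /= upd_eq upd_neq; last lia.
      rewrite (proj1 S3) // bodyi addn1.
      by apply: run1; rewrite /step /= C7.
    + have : rep (upd m2 nvars 1) (iteri j.+1 body st) by apply: rep_temp.
      by move/rep_setv; apply.
    + by rewrite iteriS [LHS]L3 [lg (setv _ _ _)]L1 !pmap_cat /= cats0 catA.
    + have Ec : cb c (vs (setv s i j)) = cb c (vs st).
        apply: (cb_ext Wc) => w Hw /=; rewrite upd_neq; first exact: body_ro.
        by apply: contraNneq ri => <-.
      rewrite Ec in B3; rewrite !size_cat /=; lia.
  have [tr [m1 [R1 S1 L1 B1]]] := key b (leqnn _).
  have E1 : m1 v - m1 i = 0.
    by rewrite !(proj1 S1) //= upd_eq upd_neq // body_ro // subnn.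
  exists (tr ++ [:: None; None]), (upd m1 nvars 0); split.
  + apply: run_cat R1 _; apply: run_cons; first by rewrite /step /= C2 E1.
    by apply: run1; rewrite /step /= C3 upd_eq.
  + exact: rep_temp.
  + by rewrite pmap_cat /= cats0.
  + by rewrite size_cat /=; lia.
- move=> /codeat_cat[C1 /= [C2 _]] Fe Hr.
  have [m1 [R1 S1 V1 U1]] := ecomp_run (bf st) C1 Fe (leqnn _) Hr.
  exists (rcons (nseq (size (ecomp nvars e)) None) None), m1; split=> //.
  + by apply: run_none R1 _; rewrite /step /= C2 V1 addn1 addnS.
  + by rewrite -cats1 pmap_cat pmap_id_nseq /= cats0.
  + by rewrite size_rcons size_nseq addn1.
- move=> [C1 _] _ Hr; exists [:: Some (bf st)], m; split=> //.
  + by apply: run1; rewrite /step /= C1 addn1.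
  + by rewrite /= cats1.
Qed.

(** * Step counts as polynomials of degree the loop nesting *)

Fixpoint depth c :=
  match c with
  | Seq c1 c2 | If _ c1 c2 => maxn (depth c1) (depth c2)
  | For _ _ c => (depth c).+1
  | _ => 0
  end.

(** The 8 added by a loop absorbs its overhead: [rho v * (x + 5) + 3 <= U * (x + 8)] once
    [rho v <= U] and [0 < U]. *)
Fixpoint weight c :=
  match c with
  | Seq c1 c2 => weight c1 + weight c2
  | If e c1 c2 => size (ecomp nvars e) + (weight c1 + weight c2).+2
  | For _ v c => weight c + 8
  | _ => csize c
  end.

Lemma cb_le ro c rho U : wf ro c -> 0 < U -> (forall v, ro v -> rho v <= U) ->
  cb c rho <= weight c * U ^ depth c.
Proof.
move=> + U0 HU; elim: c => [|v e|a e|c1 IH1 c2 IH2|e c1 IH1 c2 IH2|i v c IH|e|] /=;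
  rewrite ?expn0 ?muln1 //.
- move=> /andP[/IH1 H1 /IH2 H2]; rewrite mulnDl.
  by apply: leq_add; [apply: leq_trans H1 _|apply: leq_trans H2 _];
    rewrite leq_mul2l leq_pexp2l ?orbT // leq_max leqnn ?orbT.
- move=> /and3P[_ /IH1 H1 /IH2 H2].
  have p1 : U ^ depth c1 <= U ^ maxn (depth c1) (depth c2) by rewrite leq_pexp2l ?leq_max ?leqnn.
  have p2 : U ^ depth c2 <= U ^ maxn (depth c1) (depth c2) by rewrite leq_pexp2l ?leq_max ?leqnn ?orbT.
  have : 0 < U ^ maxn (depth c1) (depth c2) by rewrite expn_gt0 U0.
  move: (U ^ depth c1) (U ^ depth c2) (U ^ maxn _ _) p1 p2 H1 H2 => x y z p1 p2 H1 H2 z0.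
  have := leq_mul (leqnn (weight c1)) p1; have := leq_mul (leqnn (weight c2)) p2.
  move: (size _) => q q1 q2; nia.
- move=> /and5P[_ _ /HU Hv _ /andP[_ /IH H]]; rewrite expnS.
  have : 0 < U ^ depth c by rewrite expn_gt0 U0.
  move: (U ^ depth c) H => z H z0.
  have := leq_mul Hv (leq_add H (leqnn 5)); have := leq_mul U0 z0; nia.
Qed.

(** * The bounded search tree *)

Section Search.
Variables (n k d b : nat) (s : nat -> nat -> bool).

(** String 0 is the one being flipped and [y] is the characteristic vector of the flips, so this bit
    marks a disagreement between the flipped string and string [a]. *)
Definition mis (y : nat -> bool) a j : bool := y j (+) s 0 j (+) s a j.
Definition dist y a := \sum_(0 <= j < n) mis y a j.
Definition wt (y : nat -> bool) := \sum_(0 <= j < n) y j.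
Definition feas y := all (fun a => dist y a <= d) (iota 0 k).

Definition setb (y : nat -> bool) p : nat -> bool := fun j => (j == p) || y j.

(** Later indices overwrite earlier ones, as in the scan made by [cBad], so that the program and
    this function pick the same string. *)
Definition badof y r :=
  iteri k (fun a o => if d < dist y a + r then Some a else o) None.

Definition cand i y a : pred nat := fun j => [&& i <= j, ~~ y j & mis y a j].
Definition cands i y a := [seq j <- iota 0 n | cand i y a j].

(* The base-[b] digits of [q], least significant first, select the branches. *)
Fixpoint search f i y r q :=
  if f is f'.+1 then
    if badof y r is Some a then
      if r is r'.+1 then
        (q %% b < size (cands i y a)) &&
        search f' i (setb y (nth 0 (cands i y a) (q %% b))) r' (q %/ b)
      else false
    else true
  else false.

Definition extends i (y y' : nat -> bool) r :=
  [/\ forall j, j < i -> y' j = y j, forall j, y j -> y' j,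
      wt y' = wt y + r & feas y'].

Definition free i (y : nat -> bool) := \sum_(i <= j < n) ~~ y j.

Lemma badofP y r :
  if badof y r is Some a then a < k /\ d < dist y a + r
  else forall a, a < k -> dist y a + r <= d.
Proof.
rewrite /badof; elim: k => //= m.
set o := iteri m _ _; case: ltnP => H.
  by split=> //; lia.
case: o => [a [H1 H2]|H1 a]; first by split=> //; lia.
by rewrite ltnS leq_eqVlt => /orP[/eqP -> //|/H1].
Qed.

Lemma sum_delta m p : \sum_(0 <= j < m) (j == p) = (p < m).
Proof.
elim: m => [|m IH]; first by rewrite big_nil.
by rewrite big_nat_recr //= IH; case: (ltngtP p m) => H; lia.
Qed.

Lemma dist_setb y p a : dist (setb y p) a <= (dist y a).+1.
Proof.
have: dist (setb y p) a <= \sum_(0 <= j < n) (mis y a j + (j == p)).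
  by apply: leq_sum => j _; rewrite /mis /setb; case: eqP; case: (y j) (s 0 j) (s a j) => [] [] [].
by rewrite big_split sum_delta /= -/(dist y a) => H; apply: leq_trans H _; case: (p < n); lia.
Qed.

Lemma wt_setb y p : p < n -> ~~ y p -> wt (setb y p) = (wt y).+1.
Proof.
move=> Hp Hy; have ->: wt (setb y p) = \sum_(0 <= j < n) (y j + (j == p)).
  apply: eq_bigr => j _; rewrite /setb; case: eqP => [->|_] /=; last by rewrite addn0.
  by rewrite (negbTE Hy).
by rewrite big_split sum_delta Hp /= addn1.
Qed.

Lemma free_setb i y p : free i (setb y p) + 1 >= free i y.
Proof.
rewrite /free; case: (leqP i n) => Hi; last by rewrite !big_geq // ltnW.
have: \sum_(i <= j < n) (j == p) <= 1.
  apply: (@leq_trans (p < n)); last exact: leq_b1.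
  by rewrite -(sum_delta n p) (@big_cat_nat _ _ _ i 0 n) //= leq_addl.
move=> H; apply: leq_trans (leq_add (leqnn _) H); rewrite -big_split /=.
by apply: leq_sum => j _; rewrite /setb; case: eqP; case: (y j).
Qed.

Lemma free_ex i y : 0 < free i y -> exists2 p, i <= p < n & ~~ y p.
Proof.
case: (boolP (has (fun j => ~~ y j) (index_iota i n))) => [/hasP[p]|/hasPn H].
  by rewrite mem_index_iota => Hp Hy _; exists p.
rewrite /free big_nat big1 // => j Hj.
by have := H j; rewrite mem_index_iota => /(_ Hj) /negbNE ->.
Qed.

Lemma extends_trans i y p y' r : i <= p -> p < n -> ~~ y p ->
  extends i (setb y p) y' r -> extends i y y' r.+1.
Proof.
move=> Hip Hp Hy [H1 H2 H3 H4]; split=> // [j Hj|j Hj|].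
- by rewrite H1 // /setb; case: eqP => // E; lia.
- by apply: H2; rewrite /setb Hj orbT.
- by rewrite H3 wt_setb // addSnnS.
Qed.

(** Each added position raises any distance by at most one, so a slack of [r] at every string pays
    for an arbitrary choice of [r] free positions. *)
Lemma extends_free i y r : (forall a, a < k -> dist y a + r <= d) ->
  r <= free i y -> exists y', extends i y y' r.
Proof.
elim: r y => [|r IH] y H Hf.
  exists y; split; rewrite ?addn0 //; apply/allP => a; rewrite mem_iota => /H; lia.
have [p /andP[Hp1 Hp2] Hy] := free_ex (leq_ltn_trans (leq0n _) Hf).
case: (IH (setb y p)).
- by move=> a /H; have := dist_setb y p a; lia.
- by have := free_setb i y p; lia.
- by move=> y' /extends_trans He; exists y'; apply: He.
Qed.

(** Room for [r] more positions is used only at a successful leaf, and it survives branching: [r]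
    drops by one and the number of free positions by at most one. *)
Lemma search_sound f i y r q : search f i y r q -> r <= free i y ->
  exists y', extends i y y' r.
Proof.
elim: f y r q => //= f IH y r q; have := badofP y r.
case: badof => [a _|H _]; last exact: extends_free.
case: r => // r /andP[Hq /IH{}IH] Hr.
have := mem_nth 0 Hq; rewrite mem_filter mem_iota add0n => /andP[/and3P[H1 H2 H3] H4].
case: IH => [|y' Hy'].
  by have := free_setb i y (nth 0 (cands i y a) (q %% b)); lia.
by exists y'; apply: extends_trans Hy'.
Qed.

Lemma cands_dist i y a : size (cands i y a) <= dist y a.
Proof.
rewrite /cands /dist size_filter /index_iota subn0.
elim: (iota 0 n) => [|j l IH]; rewrite ?big_nil // big_cons /=.
apply: leq_add IH; rewrite /cand; case: (mis y a j); rewrite ?andbF // leq_b1 //.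
Qed.

(* Adding [r] positions to [y] changes its distance to string [a] by at most
   [r], with equality upwards unless one of them was a mismatch. *)
Lemma dist_extends i y y' r a : extends i y y' r ->
  dist y a <= dist y' a + r /\
  (dist y' a < dist y a + r ->
   exists2 p, p \in cands i y a & y' p).
Proof.
move=> [H1 H2 H3 _].
have Er : r = \sum_(0 <= j < n) (y' j && ~~ y j).
  move: H3; rewrite /wt; have ->: \sum_(0 <= j < n) y' j = \sum_(0 <= j < n) (y j + (y' j && ~~ y j)).
    by apply: eq_bigr => j _; have := H2 j; case: (y j) (y' j) => [] [] // /(_ isT).
  by rewrite big_split /=; lia.
split.
  rewrite Er -big_split; apply: leq_sum => j _ /=; rewrite /mis.
  by have := H2 j; case: (y j) (y' j) (s 0 j) (s a j) => [] [] [] [] // /(_ isT).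
case: (boolP (has y' (cands i y a))) => [/hasP[p Hp Hy]|/hasPn H] Hlt; first by exists p.
suff: dist y a + r <= dist y' a by lia.
rewrite Er -big_split; rewrite [X in X <= _]big_nat [X in _ <= X]big_nat; apply: leq_sum => j Hj /=.
have := H2 j; case Ey: (y j); first by move=> /(_ isT) ->; rewrite andbF /mis addn0 Ey; have := H2 j; rewrite Ey => /(_ isT) ->.
move=> _; case Ey': (y' j); last by rewrite /mis Ey Ey' addn0.
have: j \notin cands i y a.
  by apply/negP => /H; rewrite Ey'.
rewrite mem_filter mem_iota add0n Hj andbT /cand Ey /=.
case: (leqP i j) => Hij /=; last by have := H1 j Hij; rewrite Ey Ey'.
by rewrite /mis Ey Ey'; case: (s 0 j) (s a j) => [] [].
Qed.

(** The branch number is built along [y']. At a bad string [a], [dist y' a <= d < dist y a + r], so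
    [y'] contains a candidate; there are at most [dist y a <= d + r < b] candidates, so its index
    fits in one digit. *)
Lemma search_complete f i y y' r : extends i y y' r -> r < f -> d + r < b ->
  exists2 q, q < b ^ r & search f i y r q.
Proof.
elim: f y r => // f IH y r He Hr Hb /=.
have := badofP y r; case: badof => [a [Ha Hd]|_]; last by exists 0; rewrite // expn_gt0; lia.
have [D1 D2] := dist_extends a He.
have Hf : dist y' a <= d by case: He => _ _ _ /allP; apply; rewrite mem_iota.
(* With nothing left to flip, [dist y a <= dist y' a <= d] contradicts that [a] is bad. *)
case: r Hr Hb He Hd D1 D2 => [|r] Hr Hb He Hd D1 D2; first by lia.
have [p Hp Hyp] := D2 (leq_ltn_trans Hf Hd).
have Hx : index p (cands i y a) < size (cands i y a) by rewrite index_mem.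
have := Hp; rewrite mem_filter mem_iota add0n => /andP[/and3P[P1 P2 P3] P4].
have He' : extends i (setb y p) y' r.
  case: He => E1 E2 E3 E4; split=> // [j Hj|j|].
  - by rewrite E1 // /setb; case: eqP => // E; lia.
  - by rewrite /setb => /orP[/eqP ->|/E2].
  - by rewrite E3 wt_setb // addSnnS.
have [q Hq Hs] := IH _ _ He' ltac:(lia) ltac:(lia).
have Hxb : index p (cands i y a) < b.
  by have := cands_dist i y a; lia.
(* The index of the chosen candidate becomes the lowest digit, the one read first; the recursive
   branch number supplies the higher digits. *)
exists (q * b + index p (cands i y a)).
  rewrite expnS; apply: (@leq_trans (b * q.+1)); first by rewrite mulnS mulnC; lia.
  by rewrite leq_mul2l Hq orbT.
by rewrite modnMDl modn_small // divnMDl ?divn_small ?addn0 ?Hx ?nth_index //; lia.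
Qed.

End Search.

(** * The enumeration program *)

Fixpoint noput c :=
  match c with
  | Put _ _ => false
  | Seq c1 c2 | If _ c1 c2 => noput c1 && noput c2
  | For _ _ c => noput c
  | _ => true
  end.

Fixpoint quiet c :=
  match c with
  | Emit _ | Flush => false
  | Seq c1 c2 | If _ c1 c2 => quiet c1 && quiet c2
  | For _ _ c => quiet c
  | _ => true
  end.

Lemma noput_hp c st : noput c -> hp (den c st) = hp st.
Proof.
elim: c st => //=.
- by move=> c1 IH1 c2 IH2 st /andP[/IH1 H1 /IH2 H2]; rewrite H2 H1.
- by move=> e c1 IH1 c2 IH2 st /andP[/IH1 H1 /IH2 H2]; case: ifP.
- by move=> i v c IH st /IH H; elim: (vs st v) => //= m IHm; rewrite H.
Qed.

Lemma quiet_out c st : quiet c -> bf (den c st) = bf st /\ lg (den c st) = lg st.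
Proof.
elim: c st => //=.
- by move=> c1 IH1 c2 IH2 st /andP[H1 H2]; have [-> ->] := IH2 (den c1 st) H2; apply: IH1.
- by move=> e c1 IH1 c2 IH2 st /andP[/IH1 H1 /IH2 H2]; case: ifP.
- by move=> i v c IH st /IH H; elim: (vs st v) => //= m IHm; have [-> ->] := H (setv (iteri m (fun j s => den c (setv s i j)) st) i m).
Qed.

Notation vG := 0.
Notation vk := 1.
Notation vn := 2.
Notation vd := 3.
Notation vD := 4.
Notation vb := 5.
Notation vM := 6.
Notation vA := 7.
Notation vX := 8.
Notation vY := 9.
Notation vl := 10.
Notation vi := 11.
Notation vmode := 12.
Notation vrun := 13.
Notation ve := 14.
Notation vcnt := 15.
Notation vN := 16.
Notation vq := 17.
Notation vr := 18.
Notation vst := 19.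
Notation vt := 20.
Notation va := 21.
Notation vj := 22.
Notation vdist := 23.
Notation vrow := 24.
Notation vbad := 25.
Notation vbrow := 26.
Notation vdig := 27.
Notation vz := 28.
Notation vtmp := 29.

(** With truncated subtraction this is 1 if [a <= b] and 0 otherwise. *)
Definition Leq a b := Minus (Cst 1) (Minus a b).
Definition At v w := Get (Plus (Var v) w).

(** On bits, exclusive or is the sum of the two truncated differences. Row 0 of the array at [vA] is
    the flipped string, hence the first read without a row offset. *)
Definition cMis row :=
  Seq (Asg vtmp (Plus (Minus (At vY (Var vj)) (At vA (Var vj)))
                     (Minus (At vA (Var vj)) (At vY (Var vj)))))
      (Asg vtmp (Plus (Minus (Var vtmp) (At vA (Plus (Var row) (Var vj))))
                     (Minus (At vA (Plus (Var row) (Var vj))) (Var vtmp)))).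

Definition cDist1 := Seq (cMis vrow) (Asg vdist (Plus (Var vdist) (Var vtmp))).
Definition cDist := Seq (Asg vdist (Cst 0)) (For vj vn cDist1).

Definition cBad1 :=
  Seq cDist (Seq
    (If (Minus (Plus (Var vdist) (Var vr)) (Var vd))
        (Seq (Asg vbad (Cst 1)) (Asg vbrow (Var vrow))) Skip)
    (Asg vrow (Plus (Var vrow) (Var vn)))).
Definition cBad :=
  Seq (Asg vbad (Cst 0)) (Seq (Asg vrow (Cst 0)) (For va vk cBad1)).

(** Division by repeated subtraction. The number of rounds must be a read-only variable, so [vM]
    rounds are made and those after the remainder falls below [vb] do nothing. *)
Definition cDigit1 :=
  If (Leq (Var vb) (Var vdig))
     (Seq (Asg vdig (Minus (Var vdig) (Var vb))) (Asg vq (Plus (Var vq) (Cst 1))))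
     Skip.
Definition cDigit :=
  Seq (Asg vdig (Var vq)) (Seq (Asg vq (Cst 0)) (For vz vM cDigit1)).

(* The status [vst] is 0 while searching, 1 after failure, 2 after success. *)
Definition cPick2 :=
  If (Var vst)
    (If (Var vdig) (Asg vdig (Minus (Var vdig) (Cst 1)))
       (Seq (Put (Plus (Var vY) (Var vj)) (Cst 1))
       (Seq (Asg vst (Cst 0)) (Asg vr (Minus (Var vr) (Cst 1))))))
    Skip.
(** [vdig] counts down over the candidates met; the one found at zero is flipped and [vst] returns
    to 0, which makes the later candidates inert. *)
Definition cPick1 :=
  If (Leq (Var vi) (Var vj)) (If (At vY (Var vj)) Skip
    (Seq (cMis vbrow) (If (Var vtmp) cPick2 Skip))) Skip.
Definition cPick := Seq (Asg vst (Cst 1)) (For vj vn cPick1).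

Definition cStep :=
  If (Var vst) Skip
    (Seq cBad (If (Var vbad) (If (Var vr) (Seq cDigit cPick) (Asg vst (Cst 1)))
                             (Asg vst (Cst 2)))).

(** The cells of [X] from position [vi] on may hold leftovers of earlier descents, so zeros are
    copied in their place. *)
Definition cCopy1 :=
  If (Minus (Var vi) (Var vj))
     (Put (Plus (Var vY) (Var vj)) (At vX (Var vj)))
     (Put (Plus (Var vY) (Var vj)) (Cst 0)).
(** The first test is needed because truncated subtraction turns an overweight prefix into one with
    0 flips left; the second rejects more flips than there are positions left. *)
Definition cStart :=
  Seq (Asg vq (Var vN)) (Seq (Asg vr (Minus (Var vl) (Var vcnt))) (Seq (Asg vst (Cst 0))
  (Seq (If (Minus (Var vcnt) (Var vl)) (Asg vst (Cst 1)) Skip)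
       (If (Minus (Var vr) (Minus (Var vn) (Var vi))) (Asg vst (Cst 1)) Skip)))).
Definition cSim := Seq cStart (Seq (For vj vn cCopy1) (For vt vD cStep)).

Definition cCnt1 :=
  If (Minus (Var vi) (Var vj)) (Asg vcnt (Plus (Var vcnt) (At vX (Var vj)))) Skip.
Definition cExt1 := Seq cSim (If (Minus (Var vst) (Cst 1)) (Asg ve (Cst 1)) Skip).
Definition cExt :=
  Seq (Asg ve (Cst 0)) (Seq (Asg vcnt (Cst 0)) (Seq (For vj vn cCnt1) (For vN vM cExt1))).

Definition cOut1 := If (At vX (Var vj)) (Emit (Plus (Var vj) (Cst 1))) Skip.
Definition cOut := Seq (For vj vn cOut1) Flush.

Definition cDown :=
  Seq cExt (If (Var ve)
    (If (Minus (Var vn) (Var vi))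
       (Seq (Put (Plus (Var vX) (Var vi)) (Cst 0)) (Asg vi (Plus (Var vi) (Cst 1))))
       (Seq cOut (Asg vmode (Cst 1))))
    (Asg vmode (Cst 1))).

(** A last bit 1 means that both children of the parent are finished. At position 0 the tree for the
    size [vl] is exhausted, and [vrun] becomes the number of sizes left, which stops the main loop
    at 0. *)
Definition cUp :=
  If (Var vi)
    (If (At vX (Minus (Var vi) (Cst 1))) (Asg vi (Minus (Var vi) (Cst 1)))
       (Seq (Put (Plus (Var vX) (Minus (Var vi) (Cst 1))) (Cst 1)) (Asg vmode (Cst 0))))
    (Seq (Asg vl (Plus (Var vl) (Cst 1))) (Seq (Asg vmode (Cst 0))
       (Asg vrun (Minus (Var vD) (Var vl))))).

Definition cBody := If (Var vmode) cUp cDown.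

Lemma den_seq c1 c2 st : den (Seq c1 c2) st = den c2 (den c1 st).
Proof. by []. Qed.

Lemma den_asg v e st : den (Asg v e) st = setv st v (ev st e).
Proof. by []. Qed.

Lemma den_if e c1 c2 st :
  den (If e c1 c2) st = if ev st e == 0 then den c2 st else den c1 st.
Proof. by []. Qed.

Lemma den_for i v c st : den (For i v c) st =
  setv (iteri (vs st v) (fun j s => den c (setv s i j)) st) i (vs st v).
Proof. by []. Qed.

Arguments den : simpl never.

(** These are [vG] to [vY], the instance data and array addresses, constant once initialised;
    counters and flags start at [vl]. *)
Definition ro : pred nat := fun v => v < 10.

Lemma wf_body : wf ro cBody.
Proof. by []. Qed.

Fixpoint allbits h : seq (seq bool) :=
  if h is h'.+1 then map (cons false) (allbits h') ++ map (cons true) (allbits h')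
  else [:: [::]].

Lemma mem_allbits h v : (v \in allbits h) = (size v == h).
Proof.
elim: h v => [|h IH] v /=; first by rewrite inE; case: v.
rewrite mem_cat; case: v => [|c v] /=.
  by apply/negbTE; rewrite negb_or; apply/andP; split; apply/mapP => -[].
have inj c' : injective (@cons bool c') by move=> ? ? [].
have no c1 c2 : c1 != c2 -> (c1 :: v \in map (cons c2) (allbits h)) = false.
  by move=> Hc; apply/mapP => -[x _ [E _]]; rewrite E eqxx in Hc.
by rewrite eqSS -IH; case: c; rewrite mem_map // no ?orbF.
Qed.

Lemma uniq_allbits h : uniq (allbits h).
Proof.
elim: h => //= h IH; rewrite cat_uniq !map_inj_uniq ?IH /=; try by move=> ? ? [].
by rewrite andbT; apply/hasPn => x /mapP[y _ ->]; apply/mapP => -[].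
Qed.

Definition sol (w : seq bool) := [seq j.+1 | j <- iota 0 (size w) & nth false w j].

(** * Agreement of the program with the abstract search *)

Section Correct.
Variables (rho : nat -> nat) (s : nat -> nat -> bool).
Notation n := (rho vn).
Notation k := (rho vk).
Notation d := (rho vd).
Notation b := (rho vb).
Notation M := (rho vM).
Hypothesis lay1 : rho vA + k * n <= rho vX.
Hypothesis lay2 : rho vX + n <= rho vY.

Definition env st :=
  (forall v, ro v -> vs st v = rho v) /\
  (forall a j, a < k -> j < n -> hp st (rho vA + (a * n + j)) = s a j).

Definition arr p m st (y : nat -> bool) := forall j, j < m -> hp st (rho p + j) = y j.

Definition same_hp p st st' :=
  forall h, (h < rho p) || (rho p + n <= h) -> hp st' h = hp st h.

Lemma env_hp c st : env st -> wf ro c ->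
  (hp (den c st) = hp st) -> env (den c st).
Proof.
move=> [H1 H2] W E; split=> [v Hv|a j]; last by rewrite E; apply: H2.
by rewrite den_frame ?H1 // (wf_ro W).
Qed.

Lemma env_setv st v x : env st -> 9 < v -> env (setv st v x).
Proof.
move=> [H1 H2] Hv; split=> // w Hw /=; rewrite upd_neq ?H1 //.
by move: Hw; rewrite /ro; lia.
Qed.

Lemma bit_lt a j : a < k -> j < n -> rho vA + (a * n + j) < rho vX.
Proof. by move=> Ha Hj; have := leq_mul Ha (leqnn n); rewrite mulSn; lia. Qed.

Lemma mis_ok st (y : nat -> bool) a row : env st -> hp st (rho vY + vs st vj) = y (vs st vj) ->
  vs st vj < n -> a < k -> vs st row = a * n -> row != vtmp ->
  vs (den (cMis row) st) vtmp = mis s y a (vs st vj).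
Proof.
move=> [H1 H2] Hy Hj Ha Hr Hrow; rewrite /cMis den_seq !den_asg /= /upd /= !(negbTE Hrow) Hr.
rewrite !(H1 vY) // !(H1 vA) // Hy // H2 //.
have := H2 0 _ (leq_ltn_trans (leq0n _) Ha) Hj; rewrite mul0n add0n => ->.
by rewrite /mis; case: (y _) (s 0 _) (s a _) => [] [] [].
Qed.

Lemma dist_ok st y a : env st -> arr vY n st y -> a < k -> vs st vrow = a * n ->
  vs (den cDist st) vdist = dist n s y a.
Proof.
move=> He Hy Ha Hr; rewrite /cDist den_seq den_asg den_for /= /upd /= (proj1 He vn) //.
set F := fun j => _; set st0 := setv st vdist 0.
suff: forall m, m <= n -> [/\ vs (iteri m F st0) vdist = \sum_(0 <= j < m) mis s y a j,
   env (iteri m F st0), hp (iteri m F st0) = hp st & vs (iteri m F st0) vrow = a * n].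
  by move=> /(_ n (leqnn _))[].
elim=> [_|m IH Hm]; first by rewrite big_nil; split=> //; apply: env_setv.
have [I1 I2 I3 I4] := IH (ltnW Hm); rewrite iteriS.
set t := iteri m F st0 in I1 I2 I3 I4 *.
have Ht : env (setv t vj m) by apply: env_setv.
have [u Du] : exists u, u = den (cMis vrow) (setv t vj m) by eexists.
have Em : vs u vtmp = mis s y a m.
  by rewrite Du; apply: mis_ok => //=; rewrite /upd /= I3; apply: Hy.
have Eu v : v != vtmp -> v != vj -> vs u v = vs t v.
  by move=> H1 H2; rewrite Du den_frame /= ?upd_neq // negb_or H1.
split.
- have -> : F m t = setv u vdist (vs u vdist + vs u vtmp) by rewrite Du.
  by rewrite /= /upd /= Em Eu // I1 big_nat_recr.
- by apply: (env_hp Ht) => //; rewrite noput_hp.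
- by rewrite /F noput_hp.
- by rewrite /F den_frame.
Qed.

Lemma bad_ok st y : env st -> arr vY n st y ->
  if badof n k d s y (vs st vr) is Some a then
    vs (den cBad st) vbad = 1 /\ vs (den cBad st) vbrow = a * n
  else vs (den cBad st) vbad = 0.
Proof.
move=> He Hy; rewrite /cBad !den_seq !den_asg den_for /= /upd /= (proj1 He vk) //.
set F := fun j => _; set st0 := setv _ _ _.
pose o m := iteri m (fun a o => if d < dist n s y a + vs st vr then Some a else o) None.
suff: forall m, m <= k -> [/\
   if o m is Some a then vs (iteri m F st0) vbad = 1 /\ vs (iteri m F st0) vbrow = a * n
   else vs (iteri m F st0) vbad = 0,
   env (iteri m F st0), hp (iteri m F st0) = hp st, vs (iteri m F st0) vrow = m * n &
   vs (iteri m F st0) vr = vs st vr].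
  by move=> /(_ k (leqnn _))[].
elim=> [_|m IH Hm].
  by split; rewrite /= ?mul0n //; do 2 apply: env_setv => //.
have [I1 I2 I3 I4 I5] := IH (ltnW Hm); rewrite iteriS [o _]/= -/(o m).
set t := iteri m F st0 in I1 I2 I3 I4 I5 *.
have Ht : env (setv t va m) by apply: env_setv.
have [u Du] : exists u, u = den cDist (setv t va m) by eexists.
have Ed : vs u vdist = dist n s y m.
  by rewrite Du; apply: dist_ok => //=; move=> j; rewrite /= I3; apply: Hy.
have fr v : ~~ writes cDist v -> v != va -> vs u v = vs t v.
  by move=> H1 H2; rewrite Du den_frame //= upd_neq.
pose u1 := if vs u vdist + vs u vr - vs u vd == 0 then u
           else setv (setv u vbad 1) vbrow (vs u vrow).
have EF : F m t = setv u1 vrow (vs u1 vrow + vs u1 vn).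
  by rewrite /u1 Du.
split.
- rewrite EF /= /upd /= /u1 Ed !fr // I5 (proj1 I2 vd) // subn_eq0.
  by case: (leqP (dist n s y m + vs st vr) d) => _ /=; rewrite /upd /= ?fr // I4.
- by apply: (env_hp Ht) => //; rewrite noput_hp.
- by rewrite /F noput_hp.
- by rewrite EF /= /upd /= /u1; case: ifP => _ /=; rewrite /upd /= !fr // I4 (proj1 I2 vn) // mulSnr.
- by rewrite /F den_frame.
Qed.

Lemma digit_ok st : env st -> vs st vq <= M -> 0 < b ->
  vs (den cDigit st) vdig = vs st vq %% b /\ vs (den cDigit st) vq = vs st vq %/ b.
Proof.
move=> He Hq Hb; rewrite /cDigit !den_seq !den_asg den_for /= /upd /= (proj1 He vM) //.
set F := fun j => _; set st0 := setv _ _ _.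
suff: forall m, m <= M -> [/\ env (iteri m F st0),
   vs (iteri m F st0) vq * b + vs (iteri m F st0) vdig = vs st vq &
   (vs (iteri m F st0) vdig < b) || (m <= vs (iteri m F st0) vq)].
  move=> /(_ M (leqnn _))[_ E H].
  (* A quotient of at least [M] together with a remainder of at least [b] would make the number
     exceed [M]. *)
  have Hlt : vs (iteri M F st0) vdig < b by case/orP: H => // H; nia.
  by rewrite -E modnMDl modn_small // divnMDl // divn_small // addn0.
elim=> [_|m IH Hm].
  by split; rewrite /= ?orbT //; do 2 apply: env_setv => //.
have [I1 I2 I3] := IH (ltnW Hm); rewrite iteriS.
set t := iteri m F st0 in I1 I2 I3 *.
have Ht : env (setv t vz m) by apply: env_setv.
have Eb : vs t vb = b by apply: (proj1 I1).
split; first by apply: (env_hp Ht) => //; rewrite noput_hp.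
- by rewrite /F /cDigit1 den_if /= /upd /= Eb; case: ifP => H;
    rewrite ?den_seq ?den_asg /=; rewrite /upd /= ?Eb; nia.
- by rewrite /F /cDigit1 den_if /= /upd /= Eb; case: ifP => H;
    rewrite ?den_seq ?den_asg /=; rewrite /upd /= ?Eb; lia.
Qed.

Lemma pick_ok st y a : env st -> arr vY n st y -> a < k -> vs st vbrow = a * n ->
  let C := cands n s (vs st vi) y a in
  let st' := den cPick st in
  if vs st vdig < size C then
    [/\ vs st' vst = 0, vs st' vr = (vs st vr).-1 &
        hp st' = upd (hp st) (rho vY + nth 0 C (vs st vdig)) 1]
  else vs st' vst = 1 /\ hp st' = hp st.
Proof.
move=> He Hy Ha Hr; rewrite /cPick den_seq den_asg den_for /= /upd /= (proj1 He vn) //.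
set F := fun j => _; set st0 := setv _ _ _; set dg := vs st vdig.
pose C m := [seq j <- iota 0 m | cand s (vs st vi) y a j].
suff: forall m, m <= n -> 
   (if dg < size (C m) then
    [/\ vs (iteri m F st0) vst = 0, vs (iteri m F st0) vr = (vs st vr).-1 &
        hp (iteri m F st0) = upd (hp st) (rho vY + nth 0 (C m) dg) 1]
   else [/\ vs (iteri m F st0) vst = 1, vs (iteri m F st0) vr = vs st vr,
            hp (iteri m F st0) = hp st & vs (iteri m F st0) vdig = dg - size (C m)]) /\
   [/\ forall v, ro v -> vs (iteri m F st0) v = rho v,
       vs (iteri m F st0) vi = vs st vi & vs (iteri m F st0) vbrow = a * n].
  by move=> /(_ n (leqnn _))[]; rewrite -/(cands _ _ _ _ _); case: ifP => _ [].
elim=> [_|m IH Hm].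
  split; first by split=> //; rewrite subn0.
  by split=> // v Hv; rewrite /= upd_neq ?(proj1 He) //; move: Hv; rewrite /ro; lia.
have [I1 [I2 I3 I4]] := IH (ltnW Hm); rewrite iteriS.
set t := iteri m F st0 in I1 I2 I3 I4 *.
split; last first.
  split=> [v Hv||]; rewrite /F den_frame //=.
    by rewrite upd_neq ?I2 //; move: Hv; rewrite /ro; lia.
  exact: (@wf_ro ro cPick1).
have EC : C m.+1 = C m ++ (if cand s (vs st vi) y a m then [:: m] else [::]).
  by rewrite /C -(addn1 m) iotaD filter_cat /= add0n.
have nC j : j < size (C m) -> nth 0 (C m) j < m.
  by move=> /(mem_nth 0); rewrite mem_filter mem_iota => /andP[_].
(* Earlier rounds can have written only at a candidate below [m], so this cell still holds the
   original bit. *)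
have Hym : hp t (rho vY + m) = y m.
  move: I1; case: ifP => [/nC H [_ _ ->]|_ [_ _ -> _]]; last exact: Hy.
  by rewrite upd_neq ?Hy //; lia.
have Ht : env t.
  split=> // a' j Ha' Hj; have Hl := bit_lt Ha' Hj; rewrite -(proj2 He) //.
  move: I1; case: ifP => [/nC H [_ _ ->]|_ [_ _ -> _]] //.
  by rewrite upd_neq //; lia.
have {}Ht : env (setv t vj m) by apply: env_setv.
have [u Du] : exists u, u = den (cMis vbrow) (setv t vj m) by eexists.
have Em : vs u vtmp = mis s y a m by rewrite Du; apply: mis_ok => //=; rewrite /upd /=.
have Eu v : v != vtmp -> v != vj -> vs u v = vs t v.
  by move=> H1 H2; rewrite Du den_frame /= ?upd_neq // negb_or H1.
have Euj : vs u vj = m by rewrite Du den_frame.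
have Eh : hp u = hp t by rewrite Du noput_hp.
have EF : F m t = if vs st vi <= m then (if y m then setv t vj m else
    if mis s y a m then den cPick2 u else u) else setv t vj m.
  rewrite /F /cPick1 den_if /= /upd /= I3.
  have -> : (1 - (vs st vi - m) == 0) = ~~ (vs st vi <= m) by lia.
  case: (vs st vi <= m) => //=; rewrite den_if /= /upd /= (I2 vY) // Hym.
  by case: (y m) => //=; rewrite den_seq -Du den_if /= Em; case: (mis _ _ _ _).
rewrite EC; case Ec: (cand _ _ _ _ _); last first.
  rewrite cats0; have [-> -> -> ->] // : [/\ vs (F m t) vst = vs t vst, vs (F m t) vr = vs t vr,
      vs (F m t) vdig = vs t vdig & hp (F m t) = hp t].
  rewrite EF; move: Ec; rewrite /cand.
  case: (_ <= m) => //=; case: (y m) => //= ->.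
  by rewrite !Eu // Eh.
move: Ec => /and3P[c1 c2 c3]; rewrite EF c1 (negbTE c2) c3 size_cat addn1 /cPick2 den_if /=.
move: I1; case: ltnP => [Hd [i1 i2 i3]|Hd [i1 i2 i3 i4]].
  by rewrite ltnS ltnW // Eu // i1 /= !Eu // Eh i3 nth_cat Hd.
rewrite Eu // i1 den_if /= Eu // i4 subn_eq0 ltnS.
case: leqP => Hd' /=.
  rewrite /upd /= Eu // i2 subn1; split=> //; rewrite -/(upd _ _ _).
  have -> : dg = size (C m) by apply/eqP; rewrite eqn_leq Hd'.
  by rewrite Eh i3 Euj Eu // (I2 vY) // nth_cat ltnn subnn.
by rewrite /upd /= !Eu // Eh i4; split=> //; lia.
Qed.

Lemma env_same c st p : env st -> wf ro c -> rho vX <= rho p ->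
  same_hp p st (den c st) -> env (den c st).
Proof.
move=> [H1 H2] W Hp E; split=> [v Hv|a j Ha Hj].
  by rewrite den_frame ?H1 // (wf_ro W).
by rewrite E ?H2 //; have := bit_lt Ha Hj; lia.
Qed.

Lemma same_refl p st st' : hp st' = hp st -> same_hp p st st'.
Proof. by move=> H h _; rewrite H. Qed.

Lemma same_trans p st1 st2 st3 : same_hp p st1 st2 -> same_hp p st2 st3 ->
  same_hp p st1 st3.
Proof. by move=> H1 H2 h Hh; rewrite H2 ?H1. Qed.

Lemma XY : rho vX <= rho vY.
Proof. by lia. Qed.

(** One round of [cStep] consumes one unit of the fuel of [search]. The equations are stated for
    every fuel so that the loop can apply them to whatever fuel is left. *)
Lemma step_ok st y : env st -> arr vY n st y -> vs st vq <= M -> 0 < b ->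
  vs st vst = 0 ->
  let st' := den cStep st in
  let srch f := search n k d b s f.+1 (vs st vi) y (vs st vr) (vs st vq) in
  [/\ same_hp vY st st', vs st' vq <= M & exists2 y', arr vY n st' y' &
   [\/ vs st' vst = 0 /\ (forall f, srch f =
          search n k d b s f (vs st vi) y' (vs st' vr) (vs st' vq)),
       vs st' vst = 1 /\ (forall f, srch f = false) |
       vs st' vst = 2 /\ (forall f, srch f = true)]].
Proof.
move=> He Hy Hq Hb H0 st' srch.
have [u Du] : exists u, u = den cBad st by eexists.
have Eh : hp u = hp st by rewrite Du noput_hp.
have Eu v : ~~ writes cBad v -> vs u v = vs st v by move=> H; rewrite Du den_frame.
have Hu : env u by rewrite Du; apply: env_hp => //; rewrite noput_hp.
have := bad_ok He Hy; rewrite -Du => HB.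
have Es : st' = den (If (Var vbad) (If (Var vr) (Seq cDigit cPick) (Asg vst (Cst 1)))
                             (Asg vst (Cst 2))) u.
  by rewrite /st' /cStep den_if /= H0 /= Du.
move: HB Es; rewrite /srch {srch} /=; case Ebad: badof => [a|] HB Es; last first.
  have {}Es : st' = setv u vst 2 by rewrite Es den_if /= HB.
  rewrite Es; split; first by apply: same_refl; rewrite /= Eh.
    by rewrite /= /upd /= Eu.
  exists y; first by move=> j Hj; rewrite /= Eh Hy.
  by apply: Or33.
have Hak : a < k /\ d < dist n s y a + vs st vr.
  by have := badofP n k d s y (vs st vr); rewrite Ebad.
case: HB => HB1 HB2.
case Er: (vs st vr) => [|r].
  have {}Es : st' = setv u vst 1 by rewrite Es den_if /= HB1 /= den_if /= Eu // Er.
  rewrite Es; split; first by apply: same_refl; rewrite /= Eh.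
    by rewrite /= /upd /= Eu.
  exists y; first by move=> j Hj; rewrite /= Eh Hy.
  by apply: Or32.
have Hqu : vs u vq <= M by rewrite Eu.
have [w Dw] : exists w, w = den cDigit u by eexists.
have {}Es : st' = den cPick w by rewrite Es den_if /= HB1 /= den_if /= Eu // Er /= Dw.
have [D1 D2] := digit_ok Hu Hqu Hb; rewrite -Dw Eu // in D1 D2.
have Ehw : hp w = hp st by rewrite Dw noput_hp.
have Ew v : ~~ writes cDigit v -> vs w v = vs u v by move=> H; rewrite Dw den_frame.
have Hw : env w by rewrite Dw; apply: env_hp => //; rewrite noput_hp.
have Hyw : arr vY n w y by move=> j Hj; rewrite Ehw Hy.
have Hbr : vs w vbrow = a * n by rewrite Ew.
have := pick_ok Hw Hyw (proj1 Hak) Hbr; rewrite -Es D1 !Ew // !Eu // Er /=.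
have Eq : vs st' vq = vs st vq %/ b by rewrite Es den_frame.
case: ltnP => Hsz.
- case=> P1 P2; have := mem_nth 0 Hsz; move Ep: (nth 0 _ _) => p Hp P3.
  move: Hp; rewrite mem_filter mem_iota add0n => /andP[/and3P[p1 p2 p3] /andP[_ p4]].
  split.
  + by move=> h Hh; rewrite P3 Ehw upd_neq //; lia.
  + by rewrite Eq; apply: leq_trans Hq; apply: leq_div.
  + exists (setb y p).
      move=> j Hj; rewrite P3 Ehw /upd /setb eqn_add2l; case: eqP => //= _; exact: Hy.
    by apply: Or31; split=> // f; rewrite P2 Eq.
- case=> P1 P3; split.
  + by apply: same_refl; rewrite P3.
  + by rewrite Eq; apply: leq_trans Hq; apply: leq_div.
  + exists y; first by move=> j Hj; rewrite P3 Ehw Hy.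
    by apply: Or32.
Qed.

Lemma loop_ok st y T : env st -> arr vY n st y -> vs st vq <= M -> 0 < b ->
  (vs st vst = 0 /\
     T = search n k d b s (rho vD) (vs st vi) y (vs st vr) (vs st vq)) \/
  (vs st vst = 1 /\ T = false) ->
  let st' := den (For vt vD cStep) st in
  same_hp vY st st' /\ (1 < vs st' vst) = T.
Proof.
move=> He Hy Hq Hb H0; rewrite den_for /= (proj1 He vD) //.
set F := fun j => _.
suff: forall m, m <= rho vD -> [/\ env (iteri m F st), same_hp vY st (iteri m F st),
    vs (iteri m F st) vq <= M, vs (iteri m F st) vi = vs st vi &
    exists2 y', arr vY n (iteri m F st) y' &
   [\/ vs (iteri m F st) vst = 0 /\ T = search n k d b s (rho vD - m) (vs st vi)
          y' (vs (iteri m F st) vr) (vs (iteri m F st) vq),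
       vs (iteri m F st) vst = 1 /\ T = false |
       vs (iteri m F st) vst = 2 /\ T = true]].
  (* When the rounds run out the fuel is 0 and [search] is false, in agreement with a status still
     at 0. *)
  move=> /(_ _ (leqnn _))[_ H1 _ _ [y' _]]; rewrite subnn /= /upd /= => H2; split=> //.
  by case: H2 => [[-> ->]|[-> ->]|[-> ->]].
elim=> [_|m IH Hm].
  split=> //; exists y; rewrite //= subn0; case: H0 => H; by [apply: Or31|apply: Or32].
have [I1 I2 I3 I4 [y' I5 I6]] := IH (ltnW Hm); rewrite iteriS.
set t := iteri m F st in I1 I2 I3 I4 I5 I6 *.
have Ht : env (setv t vt m) by apply: env_setv.
have Ei : vs (F m t) vi = vs st vi by rewrite /F den_frame.
have idle : vs t vst != 0 -> F m t = setv t vt m.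
  by move=> H; rewrite /F /cStep den_if /= /upd /= (negbTE H).
case: I6 => [[J1 J2]|[J1 J2]|[J1 J2]].
- have [K1 K2 [z Hz K3]] := @step_ok (setv t vt m) y' Ht I5 I3 Hb J1.
  split=> //; first exact: (env_same Ht _ XY K1).
    by apply: same_trans I2 _; move: K1.
  exists z => //.
  have Ef : rho vD - m = (rho vD - m.+1).+1 by lia.
  rewrite Ef -I4 in J2; rewrite -I4.
  case: K3 => [[k1 k2]|[k1 k2]|[k1 k2]]; [apply: Or31|apply: Or32|apply: Or33]; split=> //;
    rewrite J2; exact: k2.
- rewrite idle ?J1 //; split=> //; exists y' => //; exact: Or32.
- rewrite idle ?J1 //; split=> //; exists y' => //; exact: Or33.
Qed.

Lemma copy_ok st x : env st -> vs st vi <= n -> arr vX (vs st vi) st x ->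
  (forall j, vs st vi <= j -> x j = false) ->
  let st' := den (For vj vn cCopy1) st in
  same_hp vY st st' /\ arr vY n st' x.
Proof.
move=> He Hi Hx Hx0; rewrite den_for /= (proj1 He vn) //.
set F := fun j => _.
suff: forall m, m <= n -> [/\ env (iteri m F st), same_hp vY st (iteri m F st),
    vs (iteri m F st) vi = vs st vi & arr vY m (iteri m F st) x].
  by move=> /(_ _ (leqnn _))[].
elim=> [_|m IH Hm]; first by split.
have [I1 I2 I3 I4] := IH (ltnW Hm); rewrite iteriS.
set t := iteri m F st in I1 I2 I3 I4 *.
have Ht : env (setv t vj m) by apply: env_setv.
have Eh : hp (F m t) = upd (hp t) (rho vY + m) (x m).
  rewrite /F /cCopy1 den_if /= {1}/upd /= I3 subn_eq0.
  case: leqP => H; rewrite /= /upd /= (proj1 I1 vY) //.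
    by rewrite Hx0.
  by rewrite (proj1 I1 vX) // I2 ?Hx //; lia.
have Es : same_hp vY t (F m t) by move=> h Hh; rewrite Eh upd_neq //; lia.
split.
- by apply: (env_same Ht _ XY).
- exact: same_trans I2 Es.
- by rewrite /F den_frame.
- move=> j; rewrite ltnS leq_eqVlt Eh /upd eqn_add2l => /orP[/eqP ->|Hj]; first by rewrite eqxx.
  by rewrite ltn_eqF // I4.
Qed.

Lemma sim_ok st x : env st -> vs st vi <= n -> arr vX (vs st vi) st x ->
  (forall j, vs st vi <= j -> x j = false) -> vs st vN <= M -> 0 < b ->
  let st' := den cSim st in
  let r := vs st vl - vs st vcnt in
  same_hp vY st st' /\
  (1 < vs st' vst) = [&& vs st vcnt <= vs st vl, r <= n - vs st vi &
     search n k d b s (rho vD) (vs st vi) x r (vs st vN)].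
Proof.
move=> He Hi Hx Hx0 HN Hb.
have [u Du] : exists u, u = den cStart st by eexists.
have Eu v : v < 17 -> vs u v = vs st v by move=> H; rewrite Du den_frame //=; lia.
have [q1 q2 q3] : [/\ vs u vq = vs st vN, vs u vr = vs st vl - vs st vcnt &
   vs u vst = ~~ ((vs st vcnt <= vs st vl) && (vs st vl - vs st vcnt <= n - vs st vi))].
  pose u0 := setv (setv (setv st vq (vs st vN)) vr (vs st vl - vs st vcnt)) vst 0.
  have [u1 D1] : exists u1, u1 = if vs st vcnt - vs st vl == 0 then u0 else setv u0 vst 1.
    by eexists.
  have -> : u = if vs u1 vr - (vs u1 vn - vs u1 vi) == 0 then u1 else setv u1 vst 1.
    by rewrite Du D1.
  rewrite D1 {D1} !subn_eq0; case: (leqP (vs st vcnt)) => _; rewrite /= /upd /= (proj1 He vn) //.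
    by case: (leqP (_ - _)) => _.
  by case: (leqP (_ - _)) => _.
have Eh : hp u = hp st by rewrite Du noput_hp.
have Hu : env u by rewrite Du; apply: env_hp => //; rewrite noput_hp.
have [w Dw] : exists w, w = den (For vj vn cCopy1) u by eexists.
have [C1 C2] : same_hp vY u w /\ arr vY n w x.
  by rewrite Dw; apply: copy_ok => //; rewrite Eu // => j; rewrite Eh; apply: Hx.
have Ew v : v != vj -> vs w v = vs u v by move=> H; rewrite Dw den_frame //= negb_or H.
have Hw : env w by rewrite Dw; apply: (env_same Hu _ XY); rewrite -?Dw.
rewrite /cSim (den_seq cStart) -Du den_seq -Dw /=.
set T := [&& _, _ & _].
have Hv : vs w vq <= M by rewrite Ew // q1.
have J : (vs w vst = 0 /\
     T = search n k d b s (rho vD) (vs w vi) x (vs w vr) (vs w vq)) \/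
  (vs w vst = 1 /\ T = false).
  rewrite !Ew // (Eu vi) // q1 q2 q3 /T.
  by case: (_ <= vs st vl) => /=; last (by right); case: (_ <= n - _) => /=; [left|right].
have [L1 L2] := loop_ok Hw C2 Hv Hb J.
split=> //; apply: same_trans L1; apply: same_trans C1.
exact: same_refl.
Qed.

Lemma cnt_ok st x : env st -> vs st vi <= n -> arr vX (vs st vi) st x ->
  vs st vcnt = 0 ->
  vs (den (For vj vn cCnt1) st) vcnt = \sum_(0 <= j < vs st vi) x j.
Proof.
move=> He Hi Hx H0; rewrite den_for /= (proj1 He vn) // /upd /=.
set F := fun j => _.
suff: forall m, m <= n -> [/\ env (iteri m F st), hp (iteri m F st) = hp st,
    vs (iteri m F st) vi = vs st vi &
    vs (iteri m F st) vcnt = \sum_(0 <= j < minn m (vs st vi)) x j].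
  by move=> /(_ _ (leqnn _))[_ _ _ ->]; rewrite (minn_idPr _).
elim=> [_|m IH Hm]; first by rewrite min0n big_nil; split.
have [I1 I2 I3 I4] := IH (ltnW Hm); rewrite iteriS.
set t := iteri m F st in I1 I2 I3 I4 *.
have Ht : env (setv t vj m) by apply: env_setv.
split.
- by apply: (env_hp Ht) => //; rewrite noput_hp.
- by rewrite /F noput_hp.
- by rewrite /F den_frame.
rewrite /F /cCnt1 den_if /= {1}/upd /= I3 subn_eq0.
case: leqP => H; rewrite /= /upd /= I4.
  by rewrite (minn_idPr H) (minn_idPr (leqW H)).
rewrite (minn_idPl H) (minn_idPl (ltnW H)).
by rewrite big_nat_recr //= (proj1 I1 vX) // I2 Hx.
Qed.

Lemma ext_ok st x : env st -> vs st vi <= n -> arr vX (vs st vi) st x ->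
  (forall j, vs st vi <= j -> x j = false) -> 0 < b ->
  let c := \sum_(0 <= j < vs st vi) x j in
  let r := vs st vl - c in
  same_hp vY st (den cExt st) /\
  vs (den cExt st) ve = [&& c <= vs st vl, r <= n - vs st vi &
     has (search n k d b s (rho vD) (vs st vi) x r) (iota 0 M)].
Proof.
move=> He Hi Hx Hx0 Hb c r.
have [u Du] : exists u, u = den (For vj vn cCnt1) (setv (setv st ve 0) vcnt 0) by eexists.
have Es : env (setv (setv st ve 0) vcnt 0) by do 2 apply: env_setv => //.
have Hu : env u by rewrite Du; apply: env_hp => //; rewrite noput_hp.
have Ec : vs u vcnt = c by rewrite Du; apply: cnt_ok.
have Eh : hp u = hp st by rewrite Du noput_hp.
have Eu v : v < 14 -> vs u v = vs st v.
  by move=> H; rewrite Du den_frame /= ?upd_neq //; lia.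
have Ee : vs u ve = 0 by rewrite Du den_frame.
rewrite /cExt !den_seq !den_asg [ev _ _]/= -Du den_for /= (proj1 Hu vM) // ?/upd /=.
set F := fun j => _.
suff: forall m, m <= M -> [/\ env (iteri m F u), same_hp vY u (iteri m F u),
    forall v, v < 14 -> vs (iteri m F u) v = vs st v, vs (iteri m F u) vcnt = c &
    vs (iteri m F u) ve = [&& c <= vs st vl, r <= n - vs st vi &
     has (search n k d b s (rho vD) (vs st vi) x r) (iota 0 m)]].
  move=> /(_ _ (leqnn _))[_ H _ _ H2]; split=> //.
  by apply: same_trans H; apply: same_refl.
elim=> [_|m IH Hm]; first by split; rewrite //= ?andbF.
have [I1 I2 I3 I4 I5] := IH (ltnW Hm); rewrite iteriS.
set t := iteri m F u in I1 I2 I3 I4 I5 *.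
have Ht : env (setv t vN m) by apply: env_setv.
have [w Dw] : exists w, w = den cSim (setv t vN m) by eexists.
have e1 : vs (setv t vN m) vi <= n by rewrite /= /upd /= I3.
have e2 : arr vX (vs (setv t vN m) vi) (setv t vN m) x.
  by rewrite /= /upd /= I3 // => j Hj; rewrite /= I2 ?Eh ?Hx //; lia.
have e3 j : vs (setv t vN m) vi <= j -> x j = false.
  by rewrite /= /upd /= I3 //; apply: Hx0.
have [S1 S2] := sim_ok Ht e1 e2 e3 (ltnW Hm) Hb.
rewrite -Dw /= /upd /= I4 !I3 // -/r in S1 S2.
have EF : F m t = if vs w vst - 1 == 0 then w else setv w ve 1 by rewrite Dw.
have ESF : same_hp vY t (F m t) by rewrite EF; case: ifP.
have Ew v : v < 16 -> vs w v = vs t v.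
  by move=> H; rewrite Dw den_frame /= ?upd_neq //; lia.
split.
- exact: (env_same Ht _ XY).
- exact: same_trans I2 ESF.
- by move=> v Hv; rewrite -I3 // EF; case: ifP => _ /=; rewrite ?upd_neq ?Ew //; lia.
- by rewrite EF; case: ifP => _ /=; rewrite /upd /= Ew.
rewrite -(addn1 m) iotaD has_cat /= orbF add0n.
rewrite EF; move: S2.
have -> : (vs w vst - 1 == 0) = ~~ (1 < vs w vst) by lia.
move=> ->; move: I5; case: (c <= _) => /=; last by rewrite Ew // => ->.
case: (r <= _) => /=; last by rewrite Ew // => ->.
by case: (search _ _ _ _ _ _ _ _ _ m) => /=; rewrite ?orbT ?orbF ?Ew.
Qed.

(** * Exactness of the oracle and the moves of the traversal *)

Hypothesis HD : rho vD = d.+1.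
Hypothesis Hb : b = 2 * d + 2.
Hypothesis HM : M = b ^ d.+1.

Definition good l u :=
  [&& size u == n, wt n (nth false u) == l & feas n k d s (nth false u)].

Definition ext l w := has (fun v => good l (w ++ v)) (allbits (n - size w)).

Lemma wt_eq y y' : (forall j, j < n -> y j = y' j) -> wt n y = wt n y'.
Proof. by move=> H; rewrite /wt !big_nat; apply: eq_bigr => j /andP[_ /H ->]. Qed.

Lemma feas_eq y y' : (forall j, j < n -> y j = y' j) -> feas n k d s y = feas n k d s y'.
Proof.
move=> H; apply: eq_all => a; congr (_ <= _).
by rewrite /dist !big_nat; apply: eq_bigr => j /andP[_ Hj]; rewrite /mis H.
Qed.

Lemma wt_pre w : size w <= n -> wt n (nth false w) = \sum_(0 <= j < size w) nth false w j.
Proof.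
move=> Hw; rewrite /wt (@big_cat_nat _ _ _ (size w)) //= [X in _ + X](_ : _ = 0) ?addn0 //.
by rewrite big_nat big1 // => j /andP[Hj _]; rewrite nth_default.
Qed.

Lemma free_pre w : size w <= n -> free n (size w) (nth false w) = n - size w.
Proof.
move=> Hw; rewrite /free big_nat (eq_bigr (fun=> 1)) -?big_nat ?sum_nat_const_nat ?muln1 //.
by move=> j /andP[Hj _]; rewrite nth_default.
Qed.

(** The values of [vD], [vb] and [vM] are used here: at most [r = l - c <= d] flips remain, so fuel
    [d.+1] exceeds [r], the base exceeds [d + r], and [b ^ r <= M] numbers are enough. *)
Lemma ext_search l w (c := \sum_(0 <= j < size w) nth false w j) :
  size w <= n -> l <= d ->
  [&& c <= l, l - c <= n - size w &
    has (search n k d b s (rho vD) (size w) (nth false w) (l - c)) (iota 0 M)] = ext l w.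
Proof.
move=> Hw Hl; apply/idP/hasP => [/and3P[H1 H2 /hasP[q _ Hq]]|[v]].
  have [|y' [Y1 Y2 Y3 Y4]] := search_sound Hq; first by rewrite free_pre.
  exists [seq y' j | j <- iota (size w) (n - size w)].
    by rewrite mem_allbits size_map size_iota.
  have E j : j < n -> nth false (w ++ [seq y' j | j <- iota (size w) (n - size w)]) j = y' j.
    move=> Hj; rewrite nth_cat; case: ltnP => Hjw; first by rewrite Y1.
    by rewrite (nth_map 0) ?size_iota ?nth_iota ?subnKC //; lia.
  rewrite /good size_cat size_map size_iota subnKC // eqxx (wt_eq E) (feas_eq E) Y4 andbT /=.
  by rewrite Y3 wt_pre // -/c subnKC.
rewrite mem_allbits => /eqP Hv /and3P[_ /eqP G2 G3].
set y' := nth false (w ++ v) in G2 G3.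
have E j : j < size w -> y' j = nth false w j by move=> H; rewrite /y' nth_cat H.
have EW : wt n y' = c + \sum_(size w <= j < n) y' j.
  rewrite /wt (@big_cat_nat _ _ _ (size w)) //=; congr (_ + _).
  by rewrite /c !big_nat; apply: eq_bigr => j /andP[_ /E ->].
have Hc : c <= l by rewrite -G2 EW leq_addr.
have Hr : l - c <= n - size w.
  rewrite -G2 EW addKn; apply: (@leq_trans (\sum_(size w <= j < n) 1)).
    by apply: leq_sum => j _; apply: leq_b1.
  by rewrite sum_nat_const_nat muln1.
have He : extends n k d s (size w) (nth false w) y' (l - c).
  split=> // [j Hj|]; last by rewrite wt_pre // -/c subnKC.
  (* A set bit of [w] lies within its length, since [nth] defaults to false beyond it. *)
  by rewrite E //; apply: contraTT Hj; rewrite -leqNgt => /(nth_default false) ->.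
rewrite Hc Hr /=.
have [||q Hq Hs] := search_complete (b := b) (f := rho vD) He; try by rewrite ?HD ?Hb; lia.
apply/hasP; exists q => //; rewrite mem_iota add0n /=.
apply: leq_trans Hq _; rewrite HM leq_pexp2l //; lia.
Qed.

(** Mode 0: the prefix [w] is about to be tested. Mode 1: everything below [w] has been dealt with.
    The cells of [X] beyond [w] are left arbitrary. *)
Definition Inv st l w mode :=
  [/\ env st, [/\ vs st vi = size w, vs st vl = l, vs st vmode = mode & vs st vrun = d.+1 - l],
      size w <= n, arr vX (size w) st (nth false w) & bf st = [::]].

Lemma out_ok st x : vs st vn = n -> vs st vX = rho vX -> arr vX n st x -> bf st = [::] ->
  [/\ hp (den cOut st) = hp st, bf (den cOut st) = [::] &
    lg (den cOut st) = rcons (lg st) [seq j.+1 | j <- iota 0 n & x j]].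
Proof.
move=> H1 H2 Hx Hb0; rewrite /cOut den_seq den_for /= H1.
set F := fun j => _.
suff: forall m, m <= n -> [/\ hp (iteri m F st) = hp st,
    bf (iteri m F st) = [seq j.+1 | j <- iota 0 m & x j], lg (iteri m F st) = lg st &
    vs (iteri m F st) vX = rho vX].
  by move=> /(_ _ (leqnn _))[h1 h2 h3 h4]; split; rewrite /= ?h1 ?h2 ?h3.
elim=> [_|m IH Hm] //.
have [I1 I2 I3 I4] := IH (ltnW Hm); rewrite iteriS.
set t := iteri m F st in I1 I2 I3 I4 *.
have EF : F m t = if x m then State (upd (vs t) vj m) (hp t) (rcons (bf t) (m + 1)) (lg t)
                  else setv t vj m.
  have Ex : hp t (rho vX + m) = x m by rewrite I1 Hx.
  by rewrite /F /cOut1 den_if /= /upd /= I4 Ex; case: (x m).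
rewrite EF -[in iota _ _](addn1 m) iotaD filter_cat map_cat /=.
by case: (x m) => /=; rewrite ?cats0 // -cats1 I2 addn1.
Qed.

Lemma down_ok st l w : Inv st l w 0 -> l <= d ->
  let st' := den cBody st in
  if ext l w then
    if size w < n then Inv st' l (rcons w false) 0 /\ lg st' = lg st
    else Inv st' l w 1 /\ lg st' = rcons (lg st) (sol w)
  else Inv st' l w 1 /\ lg st' = lg st.
Proof.
move=> [He [Hi Hl Hm Hr] Hw Hx Hbf] Hld st'.
have [u Du] : exists u, u = den cExt st by eexists.
have x0 j : vs st vi <= j -> nth false w j = false by rewrite Hi; apply: nth_default.
have b0 : 0 < b by lia.
have [] := ext_ok He (x := nth false w); rewrite ?Hi //; first by move=> j; rewrite -Hi; apply: x0.
rewrite -Du Hl ext_search // => S1 S2.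
have Hu : env u by rewrite Du; apply: (env_same He _ XY); rewrite -?Du.
have Eu v : v < 14 -> vs u v = vs st v by move=> H; rewrite Du den_frame //=; lia.
have Xu : arr vX (size w) u (nth false w).
  by move=> j Hj; rewrite S1 ?Hx //; lia.
have [Bu Lu] : bf u = [::] /\ lg u = lg st.
  by have [] := @quiet_out cExt st isT; rewrite -Du Hbf.
have Es : st' = den (If (Var ve)
    (If (Minus (Var vn) (Var vi))
       (Seq (Put (Plus (Var vX) (Var vi)) (Cst 0)) (Asg vi (Plus (Var vi) (Cst 1))))
       (Seq cOut (Asg vmode (Cst 1))))
    (Asg vmode (Cst 1))) u.
  by rewrite /st' /cBody den_if /= Hm /= Du.
move: Es; rewrite den_if /= S2; case: (ext l w) => /= Es; last first.
  rewrite Es; split=> //; split=> //; first exact: env_setv.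
  by rewrite /= /upd /= !Eu.
move: Es; rewrite den_if /= (proj1 Hu vn) // Eu // Hi subn_eq0 ltnNge.
case: leqP => Hwn /= Es.
  have En : size w = n by lia.
  have [o1 o2 o3] : [/\ hp (den cOut u) = hp u, bf (den cOut u) = [::] &
    lg (den cOut u) = rcons (lg u) [seq j.+1 | j <- iota 0 n & nth false w j]].
    by apply: out_ok; rewrite ?(proj1 Hu) // -En.
  have [z Dz] : exists z, z = den cOut u by eexists.
  have Ez v : v != vj -> vs z v = vs u v by move=> H; rewrite Dz den_frame /= ?orbF.
  rewrite -Dz in o1 o2 o3.
  have {}Es : st' = setv z vmode 1 by rewrite Es Dz.
  rewrite Es /= o3 Lu /sol En; split=> //; split=> //.
  - by apply: env_setv => //; rewrite Dz; apply: env_hp; rewrite -?Dz.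
  - by rewrite /= /upd /= !Ez // !Eu.
  - by move=> j Hj; rewrite /= o1; apply: Xu.
have {}Es : st' = State (upd (vs u) vi (size w).+1) (upd (hp u) (rho vX + size w) 0) (bf u) (lg u).
  rewrite Es (_ : den _ u = State (upd (vs u) vi (vs u vi + 1))
    (upd (hp u) (vs u vX + vs u vi) 0) (bf u) (lg u)) //.
  by rewrite (proj1 Hu vX) // Eu // Hi addn1.
rewrite Es /= Lu; split=> //; split=> //=.
- split=> [v Hv|a j Ha Hj] /=; first by rewrite upd_neq ?(proj1 Hu) //; move: Hv; rewrite /ro; lia.
  by have := bit_lt Ha Hj => H; rewrite upd_neq ?(proj2 Hu) //; lia.
- by rewrite size_rcons /upd /= !Eu.
- by rewrite size_rcons.
- move=> j; rewrite size_rcons ltnS /= /upd eqn_add2l nth_rcons => Hj.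
  case: ltngtP Hj => // Hj _; exact: Xu.
Qed.

Lemma up_rcons st l w c : Inv st l (rcons w c) 1 ->
  let st' := den cBody st in
  (if c then Inv st' l w 1 else Inv st' l (rcons w true) 0) /\ lg st' = lg st.
Proof.
move=> [He [Hi Hl Hm Hr] Hw Hx Hbf] st'; rewrite size_rcons in Hi Hw Hx.
have Hc : hp st (rho vX + size w) = c by rewrite Hx // nth_rcons ltnn eqxx.
have Es : st' = if c then setv st vi (size w)
   else State (upd (vs st) vmode 0) (upd (hp st) (rho vX + size w) 1) (bf st) (lg st).
  rewrite /st' /cBody den_if /= Hm /= /cUp den_if /= Hi /= den_if /= Hi subn1 /=.
  rewrite (proj1 He vX) // Hc; case: c {Hx Hc} => /=; first by rewrite den_asg /= Hi subn1.
  rewrite (_ : den _ st = State (upd (vs st) vmode 0)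
    (upd (hp st) (vs st vX + (vs st vi - 1)) 1) (bf st) (lg st)) //.
  by rewrite (proj1 He vX) // Hi subn1.
case: c Hx Hc Es => Hx Hc Es; rewrite Es /=; split=> //; split=> //=.
- exact: env_setv.
- exact: ltnW.
- move=> j Hj; have := Hx j (ltnW _); rewrite nth_rcons Hj; exact.
- split=> [v Hv|a j Ha Hj] /=; first by rewrite upd_neq ?(proj1 He) //; move: Hv; rewrite /ro; lia.
  by have := bit_lt Ha Hj => H; rewrite upd_neq ?(proj2 He) //; lia.
- by rewrite size_rcons.
- by rewrite size_rcons.
- move=> j; rewrite size_rcons => Hj; have := Hx j Hj; rewrite !nth_rcons /= /upd eqn_add2l.
  by move: Hj; rewrite ltnS; case: ltngtP.
Qed.

Lemma up_nil st l : Inv st l [::] 1 ->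
  let st' := den cBody st in Inv st' l.+1 [::] 0 /\ lg st' = lg st.
Proof.
move=> [He [Hi Hl Hm Hr] Hw Hx Hbf] st'.
have -> : st' = setv (setv (setv st vl l.+1) vmode 0) vrun (d.+1 - l.+1).
  by rewrite /st' /cBody den_if /= Hm /= /cUp den_if /= Hi /= !den_seq !den_asg /= /upd /=
    (proj1 He vD) // Hl addn1 HD.
by split=> //; split=> //; do 3 apply: env_setv => //.
Qed.

End Correct.

(** * Delays *)

(* [gok B g tr]: if [g] silent steps precede [tr], no silent stretch exceeds [B];
   [gfin g tr] is then the length of the silent stretch at the end. *)
Fixpoint gok B g (tr : trace) :=
  match tr with
  | [::] => true
  | None :: t => (g < B) && gok B g.+1 t
  | Some _ :: t => gok B 0 t
  end.

Fixpoint gfin g (tr : trace) :=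
  match tr with
  | [::] => g
  | None :: t => gfin g.+1 t
  | Some _ :: t => gfin 0 t
  end.

Lemma gok_cat B g t1 t2 : gok B g (t1 ++ t2) = gok B g t1 && gok B (gfin g t1) t2.
Proof. by elim: t1 g => //= -[o|] t IH g; rewrite IH ?andbA. Qed.

Lemma gfin_cat g t1 t2 : gfin g (t1 ++ t2) = gfin (gfin g t1) t2.
Proof. by elim: t1 g => //= -[o|] t IH g; rewrite IH. Qed.

Lemma gok_size B g t : g + size t <= B -> gok B g t.
Proof. by elim: t g => //= -[o|] t IH g H; rewrite IH ?andbT //; lia. Qed.

Lemma gfin_size g t : gfin g t <= g + size t.
Proof. by elim: t g => //= [|[o|] t IH] g; [rewrite addn0|have := IH 0; lia|have := IH g.+1; lia]. Qed.

(** An output resets the count, so the silence [g] that came before is forgotten. *)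
Lemma gfin_out g t : pmap id t != [::] -> gfin g t <= size t.
Proof.
elim: t g => //= -[o|] t IH g /=; last by move=> /(IH g.+1); lia.
by move=> _; have := gfin_size 0 t; lia.
Qed.

Lemma gok_gap B g t a c : gok B g t -> g <= B -> a <= c -> c <= size t ->
  (forall i, a <= i -> i < c -> nth None t i = None) ->
  c - a <= B /\ (a = 0 -> g + c <= B).
Proof.
elim: t g a c => [|o t IH] g [|a] [|c] //=; rewrite ?addn0 //.
- by move=> Ht Hg _ Hc Hn; have := Hn 0 isT isT => /= Eo; rewrite Eo in Ht;
    case/andP: Ht => Hg1 Ht; have [] := IH g.+1 0 c Ht Hg1 isT Hc (fun i _ => Hn i.+1 isT); lia.
- move=> Ht Hg Ha Hc Hn; split=> //; rewrite subSS.
  have Hn' i : a <= i -> i < c -> nth None t i = None by move=> h1 h2; apply: (Hn i.+1).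
  case: o Ht Hn => [o|] Ht Hn; first by have [] := IH 0 a c Ht isT Ha Hc Hn'.
  by case/andP: Ht => Hg1 Ht; have [] := IH g.+1 a c Ht Hg1 Ha Hc Hn'.
Qed.

(** * The traversal on the machine and its silent stretches *)

Section Main.
Variables (rho : nat -> nat) (s : nat -> nat -> bool).
Notation n := (rho vn).
Notation k := (rho vk).
Notation d := (rho vd).
Notation b := (rho vb).
Notation M := (rho vM).
Hypothesis lay1 : rho vA + k * n <= rho vX.
Hypothesis lay2 : rho vX + n <= rho vY.
Hypothesis HD : rho vD = d.+1.
Hypothesis Hb : b = 2 * d + 2.
Hypothesis HM : M = b ^ d.+1.
Variables (P : program) (ph pend : nat).
Hypothesis code1 : nth IHalt P ph = IJz vrun pend.
Hypothesis code2 : codeat P ph.+1 (ccomp ph.+1 cBody).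
Hypothesis code3 : nth IHalt P (ph.+1 + csize cBody) = IJmp ph.

Variable C : nat.
Hypothesis HC : cb cBody rho + 2 <= C.
Notation InvR := (Inv rho s).
Notation goodR := (good rho s).
Notation extR := (ext rho s).

Lemma iter_run m st l w mode : InvR st l w mode -> l <= d -> rep m st ->
  bf (den cBody st) = [::] ->
  exists tr m', [/\ run P (Config ph m [::]) tr (Config ph m' [::]),
    rep m' (den cBody st), lg (den cBody st) = lg st ++ pmap id tr & size tr <= C].
Proof.
move=> [He [_ _ _ Hr] _ _ Hbf] Hl Hm Hbf'.
have [tr [m' [R1 R2 R3 R4]]] := ccomp_run code2 wf_body Hm.
have Hz : (m vrun == 0) = false by rewrite (proj1 Hm) // Hr; lia.
exists (None :: tr ++ [:: None]), m'; split=> //.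
- apply: run_cons.
    by rewrite /step /= code1 Hz.
  rewrite Hbf Hbf' in R1; apply: run_cat R1 (run1 _).
  by rewrite /step /= code3.
- by rewrite R3 /= pmap_cat /= cats0.
- apply: leq_trans HC; rewrite -(cb_ext wf_body (proj1 He)).
  by move: (cb _ _) R4 => c R4; rewrite /= size_cat addn1 addn2 !ltnS.
Qed.

Lemma cat_injr (T : Type) (x y z : seq T) : x ++ y = x ++ z -> y = z.
Proof. by elim: x => //= a x IH [/IH]. Qed.

Lemma cat_eq_nil (T : Type) (x y : seq T) : x = x ++ y -> y = [::].
Proof. by rewrite -{1}(cats0 x) => /cat_injr. Qed.

Lemma ext_rcons l w : size w < n ->
  extR l w = extR l (rcons w false) || extR l (rcons w true).
Proof.
move=> Hw; rewrite /ext !size_rcons (_ : n - size w = (n - (size w).+1).+1); last lia.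
rewrite /= has_cat !has_map.
by congr (_ || _); apply: eq_has => v /=; rewrite cat_rcons.
Qed.

(** [allbits] lists the false branch before the true one, so this is the order in which the
    traversal meets the solutions. *)
Definition sols l w h := [seq sol (w ++ v) | v <- allbits h & goodR l (w ++ v)].

Lemma sols_ext l w h : size w + h = n -> (sols l w h != [::]) = extR l w.
Proof.
move=> Hh; rewrite /sols -size_eq0 size_map size_filter -lt0n -has_count.
by rewrite /ext (_ : n - size w = h) //; lia.
Qed.

Lemma sols_S l w h : sols l w h.+1 = sols l (rcons w false) h ++ sols l (rcons w true) h.
Proof.
rewrite /sols /= filter_cat map_cat !filter_map -!map_comp.
by congr (_ ++ _); rewrite (eq_map (fun v => congr1 sol (cat_rcons _ _ v)));
  congr map; apply: eq_filter => v /=; rewrite cat_rcons.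
Qed.

Notation gap h := (C * (3 * h + 1)).

(** A leaf takes one round; an inner node adds at most three: its own test, the move to the right
    child and the return. A subtree with an output ends in silence bounded independently of [g]; one
    without is refuted in a single round. The bound [2 * gap n + C] allows for leaving one subtree
    and entering the next. *)
Lemma dfs B l h w m st : 2 * gap n + C <= B -> l <= d -> size w + h = n ->
  rep m st -> InvR st l w 0 ->
  exists tr m' st', [/\ run P (Config ph m [::]) tr (Config ph m' [::]),
    rep m' st', InvR st' l w 1, pmap id tr = sols l w h &
    forall g, g + gap h <= B ->
      gok B g tr /\ gfin g tr <= if extR l w then gap h else g + C].
Proof.
move=> HB Hl; elim: h w m st => [|h IH] w m st Hh Hm HI.
  have Hw : size w = n by lia.
  have := down_ok lay1 lay2 HD Hb HM HI Hl.
  have Es := sols_ext l Hh.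
  have -> : (size w < n) = false by lia.
  have E0 : sols l w 0 = if extR l w then [:: sol w] else [::].
    by move: Es; rewrite /sols /= cats0; case: (goodR l w) => /= <-; rewrite ?cats0.
  move=> HI1.
  have [HI' HL] : InvR (den cBody st) l w 1 /\ lg (den cBody st) = lg st ++ sols l w 0.
    by move: HI1; rewrite E0; case: (extR l w) => -[? ->]; rewrite ?cats1 ?cats0.
  have Hbf : bf (den cBody st) = [::] by case: HI'.
  have [tr [m' [R1 R2 R3 R4]]] := iter_run HI Hl Hm Hbf.
  have Et : pmap id tr = sols l w 0.
    by apply: (@cat_injr _ (lg st)); rewrite -R3 -HL.
  exists tr, m', (den cBody st); split=> // g Hg; split.
    by apply: gok_size; lia.
  case: ifP => He; last by have := gfin_size g tr; lia.
  have Hne : pmap id tr != [::] by rewrite Et Es.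
  by apply: leq_trans (gfin_out g Hne) _; rewrite muln0 muln1.
have Hw : size w < n by lia.
have := down_ok lay1 lay2 HD Hb HM HI Hl; rewrite Hw => HI1.
have step1 st1 l1 w1 m1 mo l2 w2 mo2 : InvR st1 l1 w1 mo -> l1 <= d -> rep m1 st1 ->
   InvR (den cBody st1) l2 w2 mo2 -> lg (den cBody st1) = lg st1 ->
   exists tr m', [/\ run P (Config ph m1 [::]) tr (Config ph m' [::]),
    rep m' (den cBody st1), pmap id tr = [::] & size tr <= C].
  move=> h1 h2 h3 h4 h5; have hbf : bf (den cBody st1) = [::] by case: h4.
  have [tr [m' [R1 R2 R3 R4]]] := iter_run h1 h2 h3 hbf.
  exists tr, m'; split=> //; apply: (@cat_eq_nil _ (lg st1)); by rewrite -R3.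
case Ee: (extR l w) HI1 => -[HI1 HL1]; last first.
  have [tr [m' [R1 R2 R3 R4]]] := step1 _ _ _ _ _ _ _ _ HI Hl Hm HI1 HL1.
  exists tr, m', (den cBody st); split=> //.
    by rewrite R3; apply/esym/eqP/negPn; rewrite sols_ext ?Ee.
  move=> g Hg; split; first by apply: gok_size; lia.
  by have := gfin_size g tr; lia.
have [t1 [m1 [A1 A2 A3 A4]]] := step1 _ _ _ _ _ _ _ _ HI Hl Hm HI1 HL1.
have Hh' c : size (rcons w c) + h = n by rewrite size_rcons; lia.
have [t2 [m2 [s2 [B1 B2 B3 B4 B5]]]] := IH _ _ _ (Hh' false) A2 HI1.
have [HI3 HL3] := up_rcons lay1 lay2 HD Hb HM B3.
have [t3 [m3 [C1 C2 C3 C4]]] := step1 _ _ _ _ _ _ _ _ B3 Hl B2 HI3 HL3.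
have [t4 [m4 [s4 [D1 D2 D3 D4 D5]]]] := IH _ _ _ (Hh' true) C2 HI3.
have [HI5 HL5] := up_rcons lay1 lay2 HD Hb HM D3.
have [t5 [m5 [E1 E2 E3 E4]]] := step1 _ _ _ _ _ _ _ _ D3 Hl D2 HI5 HL5.
exists (t1 ++ t2 ++ t3 ++ t4 ++ t5), m5, (den cBody s4); split=> //.
- by apply: run_cat A1 (run_cat B1 (run_cat C1 (run_cat D1 E1))).
- by rewrite !pmap_cat A3 B4 C3 D4 E3 cats0 sols_S.
move=> g Hg; rewrite !gok_cat !gfin_cat.
have Eh : gap h.+1 = gap h + 3 * C by lia.
have Hgn : gap h.+1 <= gap n by rewrite leq_mul2l; apply/orP; right; lia.
have G1 := gfin_size g t1.
set g1 := gfin g t1 in G1 *.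
have [K1 K2] := B5 g1 ltac:(lia).
set g2 := gfin g1 t2 in K2 *.
have G3 := gfin_size g2 t3.
set g3 := gfin g2 t3 in G3 *.
have Hg2 : g2 <= gap h \/ g2 <= g + 2 * C /\ extR l (rcons w false) = false.
  by move: K2; case: (extR l _) => ?; [left|right]; lia.
have [K3 K4] := D5 g3 ltac:(lia).
set g4 := gfin g3 t4 in K4 *.
have G5 := gfin_size g4 t5.
(* If the right child fails, the left one has an output because [w] extends, so the silence
   accumulated before [w] no longer counts. *)
have Hg4 : g4 <= gap h + 2 * C.
  move: K4; case Et: (extR l (rcons w true)) => K4; first by lia.
  move: Ee; rewrite ext_rcons // Et orbF => Ef.
  by case: Hg2 => [?|[_]]; [lia|rewrite Ef].
rewrite K1 K3 !gok_size; lia.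
Qed.

(** A size without solutions passes its silence on to the next size; the term [e * (gap n + C)] sums
    this over all remaining sizes. *)
Lemma levels B e l m st : 2 * gap n + C <= B -> l + e = d.+1 -> rep m st ->
  InvR st l [::] 0 ->
  exists tr m' st', [/\ run P (Config ph m [::]) tr (Config ph m' [::]),
    rep m' st', vs st' vrun = 0,
    pmap id tr = flatten [seq sols l' [::] n | l' <- iota l e] &
    forall g, g + e * (gap n + C) + gap n <= B ->
      gok B g tr /\ gfin g tr <= g + e * (gap n + C)].
Proof.
move=> HB; elim: e l m st => [|e IH] l m st Hl Hm HI.
  exists [::], m, st; split=> //; first exact: run_nil; last by move=> g _; rewrite mul0n addn0.
  by case: HI => _ [_ _ _ ->] _ _ _; lia.
have Hld : l <= d by lia.
have [t1 [m1 [s1 [A1 A2 A3 A4 A5]]]] := @dfs B l n [::] m st HB Hld erefl Hm HI.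
have [HI2 HL2] := up_nil lay1 lay2 HD A3.
have hbf : bf (den cBody s1) = [::] by case: HI2.
have [t2 [m2 [B1 B2 B3 B4]]] := iter_run A3 Hld A2 hbf.
have B3' : pmap id t2 = [::] by apply: (@cat_eq_nil _ (lg s1)); rewrite -B3.
have [t3 [m3 [s3 [C1 C2 C3 C4 C5]]]] := IH l.+1 m2 _ ltac:(lia) B2 HI2.
exists (t1 ++ t2 ++ t3), m3, s3; split=> //.
- exact: run_cat A1 (run_cat B1 C1).
- by rewrite !pmap_cat A4 B3' C4.
move=> g; rewrite mulSn => Hg; have [K1 K2] := A5 g ltac:(lia).
rewrite !gok_cat !gfin_cat K1; set g1 := gfin g t1 in K2 *.
have Hg1 : g1 <= g + gap n by move: K2; case: ifP => _; lia.
have G2 := gfin_size g1 t2; rewrite gok_size; last by lia.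
have [K3 K4] := C5 (gfin g1 t2) ltac:(lia).
by split=> //; lia.
Qed.

End Main.

(** * Machine-level prologue and the time function *)

(** Cell 0 is the moving target address and cell 1 holds the increment 1. With [q = 37] the cells 3
    to 39 are copied, the last one just below [hbase]. *)
Definition pro_copy q := flatten [seq [:: IAdd 0 0 1; IStore 0 c] | c <- iota 3 q].

(* The cells below [hbase] may hold input bits, so they are saved above address
   [2L + hbase], where [L] is the input length found in cell 0; cell 1
   is first parked at address [2L], to free it as a scratch register. *)
Definition pro : program :=
  [:: IAdd 0 0 0; IStore 0 1; IConst 1 hbase; IAdd 0 0 1; IStore 0 2; IConst 1 1]
  ++ pro_copy 37
  ++ [:: IConst 1 37; ISub 0 0 1; IConst 1 hbase; ISub 0 0 1; ILoad 1 0].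

Lemma pro_copyS q : pro_copy q.+1 = pro_copy q ++ [:: IAdd 0 0 1; IStore 0 (q + 3)].
Proof. by rewrite /pro_copy -(addn1 q) iotaD map_cat flatten_cat /= addnC. Qed.

Lemma size_pro_copy q : size (pro_copy q) = q.*2.
Proof. by elim: q => // q IH; rewrite pro_copyS size_cat IH /=; lia. Qed.

Lemma pro_copy_run P p m F q : codeat P p (pro_copy q) -> m 0 = F -> m 1 = 1 ->
  hbase <= F -> q + 3 <= hbase ->
  exists m', [/\ run P (Config p m [::]) (nseq q.*2 None) (Config (p + q.*2) m' [::]),
    m' 0 = F + q, m' 1 = 1, forall j, 0 < j -> j <= q -> m' (F + j) = m (j + 2) &
    forall h, 1 < h -> (h <= F) || (F + q < h) -> m' h = m h].
Proof.
move=> Hc H0 H1 HF; elim: q Hc => [|q IH] Hc Hq.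
  exists m; split; rewrite ?addn0 //; first exact: run_nil.
  by case.
move: Hc; rewrite pro_copyS => /codeat_cat[c1 /= [c2 [c3 _]]].
rewrite size_pro_copy in c2 c3.
have [m1 [R1 M0 M1 Mj Mh]] := IH c1 ltac:(lia).
pose m2 := upd m1 0 (F + q.+1).
exists (upd m2 (F + q.+1) (m1 (q + 3))); split.
- have -> : q.+1.*2 = q.*2 + 2 by lia.
  have -> : [:: None, None & nseq q.*2 None] = nseq q.*2 None ++ nseq 2 None :> trace.
    by rewrite -nseqD addn2.
  apply: run_cat R1 _.
  apply: (run_cons (c1 := Config (p + q.*2).+1 m2 [::])).
    by rewrite /step /= c2 M0 M1 -addnA addn1.
  apply: run1; rewrite /step /= c3 /= /m2 upd_eq [upd m1 _ _ _]upd_neq //; last lia.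
  by congr (Some (Config _ _ _, _)); lia.
- by rewrite upd_neq ?/m2 ?upd_eq //; lia.
- by rewrite upd_neq ?/m2 ?upd_neq //; lia.
- move=> j j0 jq; rewrite /upd eqn_add2l; case: eqP => [->|Hj].
    have -> : m1 (q + 3) = m (q + 3) by apply: Mh; lia.
    by congr m; lia.
  by rewrite /m2 upd_neq ?Mj //; lia.
- by move=> h h1 Hh; rewrite /m2 !upd_neq ?Mh //; lia.
Qed.

(** Cell [2 * L] is excluded because cell 1 was parked there; the input ends at cell [L], so no
    input is lost. [3 <= L] keeps this address away from cells 0 to 2. *)
Lemma pro_run P m L : codeat P 0 pro -> m 0 = L -> 3 <= L ->
  exists m', [/\ run P (Config 0 m [::]) (nseq (size pro) None) (Config (size pro) m' [::]),
    m' 0 = 2 * L, m' 1 = m 1,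
    forall c, 2 <= c -> c < hbase -> c != 2 * L -> m' (2 * L + (c - 2) + hbase) = m c &
    forall h, 1 < h -> h < 2 * L -> m' h = m h].
Proof.
move=> Hc H0 HL.
have Es : size pro = 6 + 37.*2 + 5 by rewrite /pro size_cat size_cat size_pro_copy.
have [c1 /codeat_cat[c2 c3]] := proj1 (codeat_cat _ _ _ _) Hc.
rewrite size_pro_copy in c3; have [i1 [i2 [i3 [i4 [i5 [i6 _]]]]]] := c1.
have [j1 [j2 [j3 [j4 [j5 _]]]]] := c3.
pose F := 2 * L + hbase.
pose ma := upd (upd m 0 (2 * L)) (2 * L) (m 1).
pose mb := upd (upd (upd (upd ma 1 hbase) 0 F) F (m 2)) 1 1.
have Rb : run P (Config 0 m [::]) (nseq 6 None) (Config 6 mb [::]).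
  apply: (run_cons (c1 := Config 1 (upd m 0 (2 * L)) [::])).
    by rewrite /step /= i1 H0 addnn mul2n.
  apply: (run_cons (c1 := Config 2 ma [::])).
    by rewrite /step /= i2 upd_eq upd_neq.
  apply: (run_cons (c1 := Config 3 (upd ma 1 hbase) [::])).
    by rewrite /step /= i3.
  apply: (run_cons (c1 := Config 4 (upd (upd ma 1 hbase) 0 F) [::])).
    rewrite /step /= i4 upd_eq upd_neq // /ma upd_neq ?upd_eq //; lia.
  apply: (run_cons (c1 := Config 5 (upd (upd (upd ma 1 hbase) 0 F) F (m 2)) [::])).
    rewrite /step /= i5 upd_eq [upd _ 0 F 2]upd_neq // upd_neq // /ma !upd_neq //; lia.
  by apply: run1; rewrite /step /= i6.
have mb0 : mb 0 = F by rewrite /mb upd_neq // upd_neq ?upd_eq // /F; lia.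
have mbh h : 1 < h -> h != 2 * L -> h != F -> mb h = m h.
  by move=> h1 h2 h3; rewrite /mb /ma !upd_neq //; lia.
have mbL : mb (2 * L) = m 1.
  by rewrite /mb 4?upd_neq ?/ma ?upd_eq // /F; lia.
have [mc [Rc C0 C1 Cj Ch]] := pro_copy_run c2 mb0 (upd_eq _ _ _) ltac:(rewrite /F; lia) isT.
pose md := upd (upd mc 1 37) 0 F.
pose me := upd (upd md 1 hbase) 0 (2 * L).
have meL : me (2 * L) = m 1.
  rewrite /me /md !upd_neq; try lia.
  by rewrite Ch ?mbL // /F; lia.
exists (upd me 1 (m 1)); split.
- rewrite Es !nseqD; apply: run_cat (run_cat Rb Rc) _.
  apply: (run_cons (c1 := Config (6 + 37.*2).+1 (upd mc 1 37) [::])).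
    by rewrite /step /= j1.
  apply: (run_cons (c1 := Config (6 + 37.*2).+2 md [::])).
    by rewrite /step /= j2 upd_eq upd_neq // C0 addnK.
  apply: (run_cons (c1 := Config (6 + 37.*2).+3 (upd md 1 hbase) [::])).
    by rewrite /step /= j3.
  apply: (run_cons (c1 := Config (6 + 37.*2).+4 me [::])).
    by rewrite /step /= j4 upd_eq upd_neq // /md upd_eq addnK.
  apply: run1; rewrite /step /= j5 /=; congr (Some (Config _ (upd _ _ _) _, _)).
  have me0 : me 0 = 2 * L by rewrite /me upd_eq.
  by rewrite me0 meL.
- by rewrite upd_neq // /me upd_eq.
- by rewrite upd_eq.
- move=> c c2' c40 cL.
  rewrite /me /md !upd_neq; try lia.
  case: (ltnP 2 c) => Hc2.
    have -> : 2 * L + (c - 2) + hbase = F + (c - 2) by rewrite /F; lia.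
    by rewrite (Cj (c - 2)) ?subnK ?mbh // /F; lia.
  have -> : 2 * L + (c - 2) + hbase = F by rewrite /F; lia.
  have -> : c = 2 by lia.
  have F1 : 1 < F by rewrite /F; lia.
  rewrite Ch ?leqnn //.
  by rewrite /mb upd_neq ?upd_eq // /F; lia.
- move=> h h1 h2; rewrite /me /md !upd_neq; try lia.
  by rewrite Ch ?mbh // /F; lia.
Qed.

Definition cPow2 := Asg vtmp (Plus (Var vtmp) (Var vM)).
Definition cPow1 := Seq (Asg vtmp (Cst 0)) (Seq (For vz vb cPow2) (Asg vM (Var vtmp))).
Definition cPow := Seq (Asg vM (Cst 1)) (For vt vD cPow1).

Lemma pow1_ok st : vs (den cPow1 st) vM = vs st vb * vs st vM.
Proof.
rewrite /cPow1 !den_seq !den_asg den_for /= /upd /=.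
set F := fun j => _; set st0 := setv st vtmp 0.
suff H m : vs (iteri m F st0) vtmp = m * vs st vM /\ vs (iteri m F st0) vM = vs st vM.
  by have [] := H (vs st vb).
elim: m => [|m [I1 I2]] //; rewrite iteriS /F /cPow2 den_asg /= /upd /=.
by rewrite -/(F) I1 I2 mulSnr.
Qed.

Lemma pow_ok st : vs (den cPow st) vM = vs st vb ^ vs st vD.
Proof.
rewrite /cPow den_seq den_asg den_for /= /upd /=.
set F := fun j => _; set st0 := setv st vM 1.
suff H m : vs (iteri m F st0) vM = vs st vb ^ m /\ vs (iteri m F st0) vb = vs st vb.
  by have [] := H (vs st vD).
elim: m => [|m [I1 I2]] //; rewrite iteriS.
set t := iteri m F st0 in I1 I2 *; rewrite /F; split; last by rewrite den_frame.
by rewrite pow1_ok /= /upd /= I1 I2 expnS.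
Qed.

Lemma step_end P p m b : size P <= p -> step P (Config p m b) = None.
Proof. by move=> H; rewrite /step /= nth_default. Qed.

(** This is the sixth power of the number [(2 * a + 2) ^ a.+1] of branch sequences: the delay is of
    order [U ^ 6], where [U] contains that number as a factor. *)
Definition tfun a := (2 * a + 2) ^ (6 * a.+1).

(** The computation is split in two commands because [cT1] assigns [vD] and [vb], which are
    read-only loop bounds in [cT2]. The argument is found in cell 1. *)
Definition cT1 :=
  Seq (Asg vD (Plus (Var 1) (Cst 1))) (Seq (Asg vb (Plus (Var vD) (Var vD)))
  (Asg vD (Plus (Plus (Plus (Var vD) (Var vD)) (Plus (Var vD) (Var vD)))
                (Plus (Var vD) (Var vD))))).
Definition cT2 := Seq cPow (Seq (Emit (Var vM)) Flush).

Definition ro2 : pred nat := fun v => v \in [:: vG; vD; vb].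

Lemma tfun_computable : RAM_computable tfun.
Proof.
pose P := ccomp 0 cT1 ++ ccomp (csize cT1) cT2 ++ [::].
exists P => a.
pose m := Defs.mem (init [:: a]).
(* The abstract state is read off the memory, so [rep] holds by definition whatever the input left
   in the cells. *)
pose st := State m (fun h => m (h + hbase)) [::] [::].
have Hm : rep m st by [].
have c1 : codeat P 0 (ccomp 0 cT1) by exact: (@codeat_self [::] (ccomp 0 cT1) (ccomp (csize cT1) cT2 ++ [::])).
have c2 : codeat P (csize cT1) (ccomp (csize cT1) cT2).
  by rewrite -(size_ccomp 0 cT1); apply: codeat_self.
have [t1 [m1 [R1 S1 L1 _]]] := @ccomp_run P pred0 0 cT1 m st c1 isT Hm.
have [t2 [m2 [R2 S2 L2 _]]] := @ccomp_run P ro2 _ cT2 m1 _ c2 isT S1.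
have Hst : step P (Config (csize cT1 + csize cT2) m2 (bf (den cT2 (den cT1 st)))) = None.
  by apply: step_end; rewrite /P cats0 size_cat !size_ccomp.
have [H1 H2] := run_halts (run_cat R1 R2) Hst.
exists (size (t1 ++ t2)); split; first exact: H1.
rewrite [LHS]H2 pmap_cat.
have E1 : pmap id t1 = [::] by apply: (@cat_eq_nil _ (lg st)); rewrite -L1.
rewrite E1 /=; apply: (@cat_injr _ (lg (den cT1 st))); rewrite -L2 L1 E1.
have [q1 q2] := @quiet_out cPow (den cT1 st) isT.
have -> : lg (den cT2 (den cT1 st)) =
  rcons (lg (den cPow (den cT1 st))) (rcons (bf (den cPow (den cT1 st))) (vs (den cPow (den cT1 st)) vM)) by [].
rewrite pow_ok q1 q2.
have -> : vs (den cT1 st) vb = 2 * a + 2.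
  by rewrite /cT1 !den_seq !den_asg /= /upd /=; rewrite /m /=; lia.
have -> : vs (den cT1 st) vD = 6 * a.+1.
  by rewrite /cT1 !den_seq !den_asg /= /upd /=; rewrite /m /=; lia.
by [].
Qed.

(** * Instances and solutions *)

Lemma mem_sol v i : i < size v -> (i.+1 \in sol v) = nth false v i.
Proof.
move=> Hi; rewrite (mem_map succn_inj).
by rewrite mem_filter mem_iota add0n Hi /= andbT.
Qed.

Lemma sorted_sol v : sorted ltn (sol v).
Proof.
rewrite /sol sorted_map; apply: sorted_filter; first exact: ltn_trans.
by have := iota_ltn_sorted 0 (size v).
Qed.

Lemma all_sol v : all (fun i => 0 < i <= size v) (sol v).
Proof.
by apply/allP => i /mapP[j]; rewrite mem_filter mem_iota add0n => /andP[_ Hj] ->.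
Qed.

Lemma size_sol v : size (sol v) = wt (size v) (nth false v).
Proof.
rewrite size_map size_filter /wt /index_iota subn0.
by elim: (iota 0 _) => [|j l IH]; rewrite ?big_nil // big_cons /= IH.
Qed.

Lemma sol_onto n S : sorted ltn S -> all (fun i => 0 < i <= n) S ->
  S = sol (mkseq (fun i => i.+1 \in S) n).
Proof.
move=> H1 /allP H2; apply: (irr_sorted_eq ltn_trans ltnn H1 (sorted_sol _)) => i.
apply/idP/idP => [Hi|].
  have := H2 i Hi; case: i Hi => // i Hi /= Hin.
  by rewrite mem_sol ?size_mkseq // nth_mkseq.
case/mapP=> j; rewrite mem_filter mem_iota add0n size_mkseq => /andP[+ Hj] ->.
by rewrite nth_mkseq.
Qed.

(** * The concatenation of all sizes as the ordered list of solutions *)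

Section Levels.
Variables (rho : nat -> nat) (s : nat -> nat -> bool).
Notation n := (rho vn).
Notation k := (rho vk).
Notation d := (rho vd).
Hypothesis k0 : 0 < k.

Definition outs_of := flatten [seq sols rho s l [::] n | l <- iota 0 d.+1].

Lemma mem_sols l S : reflect (exists2 v, good rho s l v & S = sol v) (S \in sols rho s l [::] n).
Proof.
apply: (iffP mapP) => [[v]|[v Hg E]].
  by rewrite mem_filter => /andP[Hg _] E; exists v.
exists v => //; rewrite mem_filter Hg mem_allbits.
by case/and3P: Hg.
Qed.

Lemma sols_size l S : S \in sols rho s l [::] n -> size S = l.
Proof. by case/mem_sols => v /and3P[/eqP <- /eqP Hw _] ->; rewrite size_sol. Qed.

Lemma sol_inj v w : size v = size w -> sol v = sol w -> v = w.
Proof.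
move=> H E; apply: (@eq_from_nth _ false) => // i Hi.
by rewrite -mem_sol // E mem_sol // -H.
Qed.

Lemma outs_sorted e l (o := flatten [seq sols rho s l [::] n | l <- iota l e]) :
  [/\ uniq o, pairwise (fun S S' => size S <= size S') o & {in o, forall S, l <= size S}].
Proof.
rewrite /o {o}; elim: e l => [|e IH] l //=.
have [I1 I2 I3] := IH l.+1; set o := flatten _ in I1 I2 I3 *.
have Hu : uniq (sols rho s l [::] n).
  rewrite map_inj_in_uniq ?filter_uniq ?uniq_allbits // => v w.
  rewrite !mem_filter !mem_allbits => /andP[_ /eqP Hv] /andP[_ /eqP Hw].
  by apply: sol_inj; rewrite Hv Hw.
split.
- rewrite cat_uniq Hu I1 andbT; apply/hasPn => S /I3 HS; apply/negP => /sols_size H.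
  by rewrite H ltnn in HS.
- rewrite pairwise_cat I2 andbT; apply/andP; split.
    by apply/allrelP => S S' /sols_size -> /I3 /ltnW.
  have: {in sols rho s l [::] n, forall S, size S = l} by move=> S /sols_size.
  elim: (sols _ _ _ _ _) => //= S t IHt Ht; rewrite IHt ?andbT.
    apply/allP => S' HS'; rewrite !Ht ?inE ?eqxx ?HS' ?orbT //.
  by move=> S' HS'; apply: Ht; rewrite inE HS' orbT.
- by move=> S; rewrite mem_cat => /orP[/sols_size -> //|/I3 /ltnW].
Qed.

Lemma mem_outs S : reflect
  (exists v, [/\ size v = n, feas n k d s (nth false v) & S = sol v]) (S \in outs_of).
Proof.
apply: (iffP flatten_mapP) => [[l Hl /mem_sols[v /and3P[/eqP H1 _ H3] ->]]|[v [H1 H2 ->]]].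
  by exists v.
have Hd : wt n (nth false v) <= d.
  have := allP H2 0; rewrite mem_iota /= add0n => /(_ k0).
  suff -> : dist n s (nth false v) 0 = wt n (nth false v) by [].
  by apply: eq_bigr => j _; rewrite /mis; case: (nth _ _ _) (s 0 j) => [] [].
exists (wt n (nth false v)); first by rewrite mem_iota.
by apply/mem_sols; exists v; rewrite // /good H1 !eqxx.
Qed.

End Levels.

Lemma size_encode x : cs_valid x ->
  size (cs_encode x) = size (cs_strings x) * cs_n x + 3.
Proof.
move=> [_ /allP H]; rewrite /cs_encode size_cat /= addnC; congr (_ + 3).
elim: (cs_strings x) H => //= t l IH H; rewrite size_cat size_map IH.
  by rewrite (eqP (H t _)) ?inE ?eqxx // mulSn.
by move=> u Hu; apply: H; rewrite inE Hu orbT.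
Qed.

Definition bit x a j := nth false (nth [::] (cs_strings x) a) j.

Lemma nth_encode x a j : cs_valid x -> a < size (cs_strings x) -> j < cs_n x ->
  nth 0 (cs_encode x) (a * cs_n x + j + 3) = bit x a j.
Proof.
move=> [_ /allP H] Ha Hj; rewrite /cs_encode addn3 /= /bit.
elim: (cs_strings x) a Ha H => //= t l IH [|a] Ha H.
  rewrite nth_cat size_map (eqP (H t _)) ?inE ?eqxx // mul0n add0n Hj (nth_map false) //.
  by rewrite (eqP (H t _)) ?inE ?eqxx.
rewrite nth_cat size_map (eqP (H t _)) ?inE ?eqxx // mulSn -addnA ltnNge leq_addr /= addKn IH //.
by move=> u Hu; apply: H; rewrite inE Hu orbT.
Qed.

Lemma hamming_flip x v a : cs_valid x -> size v = cs_n x -> a < size (cs_strings x) ->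
  hamming (flipS (sol v) (head [::] (cs_strings x))) (nth [::] (cs_strings x) a) =
  dist (cs_n x) (bit x) (nth false v) a.
Proof.
move=> [H0 /allP H] Hv Ha; rewrite /hamming /flipS.
have Hs : size (head [::] (cs_strings x)) = cs_n x.
  by apply/eqP/H; rewrite -nth0 mem_nth.
rewrite size_map size_iota Hs /dist big_mkord; apply: eq_bigr => j _.
rewrite (nth_map 0) ?size_iota // nth_iota // add0n mem_sol ?Hv //.
rewrite /mis /bit -nth0; case: (nth false v j) => /=;
  by case: (nth false (nth [::] _ 0) j) (nth false (nth [::] _ a) j) => [] [].
Qed.

Lemma cs_solutionP rho x S : cs_valid x -> rho vn = cs_n x -> rho vd = cs_d x ->
  rho vk = (if cs_n x == 0 then 1 else size (cs_strings x)) ->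
  S \in outs_of rho (bit x) <-> cs_solution x S.
Proof.
move=> Hx En Ed Ek.
have k0 : 0 < rho vk by rewrite Ek; case: ifP => // _; case: Hx.
have key v : size v = cs_n x -> cs_solution x (sol v) =
    feas (rho vn) (rho vk) (rho vd) (bit x) (nth false v).
  move=> Hv; rewrite /cs_solution sorted_sol -Hv all_sol /= En Ed Ek.
  have -> : all (fun t => hamming (flipS (sol v) (head [::] (cs_strings x))) t <= cs_d x)
       (cs_strings x) =
     all (fun a => dist (cs_n x) (bit x) (nth false v) a <= cs_d x) (iota 0 (size (cs_strings x))).
    rewrite -{2}(mkseq_nth [::] (cs_strings x)) /mkseq all_map; apply: eq_in_all => a.
    by rewrite mem_iota /= add0n => Ha; rewrite hamming_flip.
  (* For [n = 0] all distances vanish, so testing one string is the same as testing all of them. *)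
  rewrite /feas; case: eqP => // E0; rewrite E0.
  have D0 a : dist 0 (bit x) (nth false v) a = 0 by rewrite /dist big_nil.
  by rewrite !(eq_all (fun a => congr1 (leq^~ _) (D0 a))) !all_predT.
split=> [/(mem_outs _ k0)[v [H1 H2 ->]]|HS]; first by rewrite key -?En.
case/and3P: (HS) => H1 H2 _; have E := sol_onto H1 H2.
apply/(mem_outs _ k0); exists (mkseq (fun i => i.+1 \in S) (cs_n x)).
by rewrite -key ?size_mkseq // -E.
Qed.

(** * Initialisation *)

(** After the prologue [vG] is [2 * L], and heap cells [vG] and [vG + 1] hold the saved input cells
    2 and 3, that is [n] and [d]. The arrays start beyond the saved block. *)
Definition cInit0 :=
  Seq (Asg vn (Get (Var vG))) (Seq (Asg vd (Get (Plus (Var vG) (Cst 1))))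
  (Seq (Asg vD (Plus (Var vd) (Cst 1))) (Seq (Asg vb (Plus (Var vD) (Var vD)))
  (Seq (Asg vA (Plus (Var vG) (Cst hbase))) (Seq (Asg vX (Plus (Var vA) (Var vG)))
  (Seq (Asg vY (Plus (Var vX) (Var vG))) (Seq (Asg vl (Cst 0)) (Seq (Asg vi (Cst 0))
  (Seq (Asg vmode (Cst 0)) (Asg vrun (Var vD))))))))))).

(* With [n = 0] the number of strings is not bounded by the input size, so only
   one of them is looked at. *)
Definition cInit1 := Seq cInit0 (If (Var vn) Skip (Asg vk (Cst 1))).

(** Bit number [t] of the strings arrives in machine cell [t + 4]. For [t < 36] this is below
    [hbase] and was saved to heap cell [vG + 2 + t]; otherwise it still is heap cell [t - 36]. *)
Definition cLoad1 :=
  If (Minus (Cst 36) (Var vj))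
    (Put (Plus (Var vA) (Var vj)) (Get (Plus (Plus (Var vG) (Cst 2)) (Var vj))))
    (Put (Plus (Var vA) (Var vj)) (Get (Minus (Var vj) (Cst 36)))).
Definition cInit2 := Seq (For vj vG cLoad1) cPow.

Lemma init1_ok st (G := vs st vG) (n := hp st G) (d := hp st (G + 1)) (st' := den cInit1 st) :
  [/\ [/\ vs st' vG = G, vs st' vk = (if n == 0 then 1 else vs st vk), vs st' vn = n & vs st' vd = d],
      [/\ vs st' vD = d.+1 & vs st' vb = 2 * d + 2],
      [/\ vs st' vA = G + hbase, vs st' vX = G + hbase + G & vs st' vY = G + hbase + G + G] &
      [/\ vs st' vl = 0, vs st' vi = 0, vs st' vmode = 0 & vs st' vrun = d.+1]].
Proof.
have [u Du] : exists u, u = den cInit0 st by eexists.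
have Es : st' = if vs u vn == 0 then setv u vk 1 else u by rewrite Du.
have [En Ed] : vs u vn = n /\ vs u vd = d by rewrite Du.
have EG : vs u vG = G by rewrite Du.
have Ek : vs u vk = vs st vk by rewrite Du.
have ED : vs u vD = d + 1 by rewrite Du.
have Eb : vs u vb = (d + 1) + (d + 1) by rewrite Du.
have EA : vs u vA = G + hbase by rewrite Du.
have EX : vs u vX = G + hbase + G by rewrite Du.
have EY : vs u vY = G + hbase + G + G by rewrite Du.
have El : [/\ vs u vl = 0, vs u vi = 0, vs u vmode = 0 & vs u vrun = d + 1] by rewrite Du.
rewrite Es En; case: El => l1 l2 l3 l4.
by case: eqP => _; rewrite /= /upd /= ?En ?Ed ?EG ?Ek ?ED ?Eb ?EA ?EX ?EY ?l1 ?l2 ?l3 ?l4 addn1;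
  do ![split] => //; lia.
Qed.

Lemma load_ok st (st' := den (For vj vG cLoad1) st) (G := vs st vG) :
  G + hbase <= vs st vA ->
  forall t, t < G -> hp st' (vs st vA + t) =
    if t < 36 then hp st (G + 2 + t) else hp st (t - 36).
Proof.
move=> HA; rewrite /st' den_for -/G /=.
set F := fun j => _.
suff: forall m, m <= G -> [/\ forall h, h < vs st vA -> hp (iteri m F st) h = hp st h,
   vs (iteri m F st) vG = G, vs (iteri m F st) vA = vs st vA &
   forall t, t < m -> hp (iteri m F st) (vs st vA + t) =
    if t < 36 then hp st (G + 2 + t) else hp st (t - 36)].
  by move=> /(_ G (leqnn _))[].
elim=> [_|m IH Hm]; first by split.
have [I1 I2 I3 I4] := IH (ltnW Hm); rewrite iteriS.
set t := iteri m F st in I1 I2 I3 I4 *.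
have Eh : hp (F m t) = upd (hp t) (vs st vA + m)
    (if m < 36 then hp st (G + 2 + m) else hp st (m - 36)).
  rewrite /F /cLoad1 den_if /= {1}/upd /= subn_eq0.
  by case: (ltnP m 36) => H; rewrite /= /upd /= ?I2 I3 I1 //; lia.
split; try by rewrite /F den_frame.
  by move=> h Hh; rewrite Eh upd_neq ?I1 //; lia.
move=> j; rewrite ltnS leq_eqVlt Eh /upd eqn_add2l => /orP[/eqP ->|Hj]; first by rewrite eqxx.
by rewrite ltn_eqF // I4.
Qed.

Lemma code_ex (c0 c1 c2 c3 : seq instr) i j (P := c0 ++ c1 ++ c2 ++ i :: c3 ++ [:: j])
    (q1 := size c0) (q2 := q1 + size c1) (q3 := q2 + size c2) :
  [/\ [/\ codeat P 0 c0, codeat P q1 c1, codeat P q2 c2 & nth IHalt P q3 = i],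
      codeat P q3.+1 c3, nth IHalt P (q3.+1 + size c3) = j & size P = (q3.+1 + size c3).+1].
Proof.
have H3 : codeat P q3 (i :: c3 ++ [:: j]).
  have -> : P = (c0 ++ c1 ++ c2) ++ (i :: c3 ++ [:: j]) ++ [::] by rewrite /P cats0 !catA.
  have -> : q3 = size (c0 ++ c1 ++ c2) by rewrite !size_cat addnA.
  exact: codeat_self.
case: H3 => H3 /codeat_cat[H4 [H5 _]]; split=> //; last first.
  by rewrite /P !size_cat /= size_cat /q3 /q2 /q1 /=; lia.
split=> //.
- exact: (codeat_self [::]).
- exact: codeat_self.
- have -> : P = (c0 ++ c1) ++ c2 ++ (i :: c3 ++ [:: j]) by rewrite /P catA.
  by rewrite /q2 /q1 -size_cat; apply: codeat_self.
Qed.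

Definition p1 := size pro.
Definition p2 := p1 + csize cInit1.
Definition ph := p2 + csize cInit2.
Definition pend := (ph.+1 + csize cBody).+1.
Definition prog : program :=
  pro ++ ccomp p1 cInit1 ++ ccomp p2 cInit2 ++
  IJz vrun pend :: ccomp ph.+1 cBody ++ [:: IJmp ph].

Lemma prog_code :
  [/\ [/\ codeat prog 0 pro, codeat prog p1 (ccomp p1 cInit1),
          codeat prog p2 (ccomp p2 cInit2) & nth IHalt prog ph = IJz vrun pend],
      codeat prog ph.+1 (ccomp ph.+1 cBody), nth IHalt prog (ph.+1 + csize cBody) = IJmp ph &
      size prog = pend].
Proof.
have := code_ex pro (ccomp p1 cInit1) (ccomp p2 cInit2) (ccomp ph.+1 cBody) (IJz vrun pend) (IJmp ph).
by rewrite !size_ccomp.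
Qed.

Opaque prog p1 p2 ph pend pro.

Lemma step_exit m st : rep m st -> vs st vrun = 0 ->
  run prog (Config ph m [::]) [:: None] (Config pend m [::]).
Proof.
have [[_ _ _ H] _ _ _] := prog_code.
by move=> [Hm _] H0; apply: run1; rewrite /step /= H Hm // H0.
Qed.

Lemma init_run x (L := size (cs_encode x)) : cs_valid x ->
  exists tr m st (rho := vs st),
  [/\ run prog (init (cs_encode x)) tr (Config ph m [::]), rep m st,
      Inv rho (bit x) st 0 [::] 0, pmap id tr = [::] &
      size tr <= size pro + cb cInit1 rho + weight cInit2 * (rho vM * (6 * L + 40)) ^ 2] /\
  [/\ [/\ rho vn = cs_n x, rho vd = cs_d x,
      rho vk = (if cs_n x == 0 then 1 else size (cs_strings x)) & rho vG = 2 * L],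
      [/\ rho vD = (cs_d x).+1, rho vb = 2 * cs_d x + 2 & rho vM = rho vb ^ rho vD] &
      [/\ rho vA = 2 * L + hbase, rho vX = 2 * L + hbase + 2 * L &
      rho vY = 2 * L + hbase + 2 * L + 2 * L]].
Proof.
move=> Hx.
have [[C0 C1 C2 _] _ _ _] := prog_code.
have EL : L = size (cs_strings x) * cs_n x + 3 by apply: size_encode.
set m0 := Defs.mem (init (cs_encode x)).
have M0 : m0 0 = L by [].
have Mh c : m0 c.+1 = nth 0 (cs_encode x) c by [].
have L3 : 3 <= L by lia.
have [ma [R1 A0 A1 Ac Ah]] := pro_run C0 M0 L3.
pose sa := State ma (fun h => ma (h + hbase)) [::] [::].
have Sa : rep ma sa by [].
have En : hp sa (vs sa vG) = cs_n x.
  by rewrite /= A0; have := Ac 2 isT isT; rewrite subnn addn0 => ->; rewrite ?Mh //; lia.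
have Ed : hp sa (vs sa vG + 1) = cs_d x.
  by rewrite /= A0; have := Ac 3 isT isT => -> //; lia.
have := init1_ok sa; cbv zeta; rewrite En Ed.
have [tb [mb [R2 S2 L2 B2]]] := @ccomp_run prog pred0 p1 cInit1 ma sa C1 isT Sa.
have hb : hp (den cInit1 sa) = hp sa by apply: noput_hp.
have [bb lb] := @quiet_out cInit1 sa isT.
have Eb0 : cb cInit1 (vs sa) = cb cInit1 (fun=> 0) by [].
move: S2 R2 L2 hb bb lb; move: (den cInit1 sa) => sb S2 R2 L2 hb bb lb.
rewrite [vs sa vG]A0 [vs sa vk]A1 => -[[bG bk bn bd] [bD bbb] [bA bX bY] [bl bi bm br]].
have [tc [mc [R3 S3 L3' B3]]] := @ccomp_run prog ro2 p2 cInit2 mb sb C2 isT S2.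
have fr v : ~~ writes cInit2 v -> vs (den cInit2 sb) v = vs sb v by apply: den_frame.
have [bc lc] := @quiet_out cInit2 sb isT.
have EM : vs (den cInit2 sb) vM = vs sb vb ^ vs sb vD.
  by rewrite [den _ _](den_seq (For vj vG cLoad1)) pow_ok !den_frame.
have hpc : hp (den cInit2 sb) = hp (den (For vj vG cLoad1) sb).
  by rewrite [den _ _](den_seq (For vj vG cLoad1)) noput_hp.
exists (nseq (size pro) None ++ tb ++ tc), mc, (den cInit2 sb); split; last first.
  split; [split|split|split]; rewrite ?EM !fr //.
split=> //.
- apply: run_cat R1 _.
  by apply: run_cat R2 _; rewrite bb in R3 *; rewrite bc bb in R3.
- split=> //.
  + split=> // a j Ha Hj.
    rewrite !fr // bk bn in Ha Hj *.
    (* A position [j < n] exists, so [n] is nonzero and [vk] is the true number of strings. *)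
    have {}Ha : a < size (cs_strings x) by move: Ha; case: eqP Hj => // ->.
    have Hlt : a * cs_n x + j + 3 < L.
      by rewrite EL ltn_add2r; have := leq_mul Ha (leqnn (cs_n x)); rewrite mulSn; lia.
    rewrite -nth_encode // -Mh hpc load_ok ?bG ?bA //; last by lia.
    rewrite hb /=; case: ltnP => H.
      have <- := Ac (a * cs_n x + j + 3).+1 ltac:(lia) ltac:(lia) ltac:(lia).
      by congr ma; lia.
    have <- := Ah (a * cs_n x + j + 3).+1 ltac:(lia) ltac:(lia).
    by congr ma; lia.
  + by rewrite !fr // bi bl bm br bd subn0.
  + by rewrite bc bb.
- rewrite !pmap_cat pmap_id_nseq.
  have -> : pmap id tb = [::] by apply: (@cat_eq_nil _ (lg sa)); rewrite -L2.
  by apply: (@cat_eq_nil _ (lg sb)); rewrite -L3'.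
- rewrite size_cat size_nseq (size_cat tb) -addnA leq_add2l; apply: leq_add => //.
  apply: leq_trans B3 _.
  apply: leq_trans (@cb_le ro2 cInit2 (vs sb) (vs (den cInit2 sb) vM * (6 * L + 40)) isT _ _) _.
  + by rewrite EM bbb muln_gt0 expn_gt0; lia.
  + have HM : vs sb vb <= vs (den cInit2 sb) vM.
      by rewrite EM -{1}(expn1 (vs sb vb)) leq_pexp2l // ?bbb ?bD //; lia.
    move=> v; rewrite /ro2 !inE => /or3P[] /eqP ->.
    - have M1 : 0 < vs (den cInit2 sb) vM by apply: leq_trans HM; rewrite bbb; lia.
      by rewrite bG; apply: leq_trans (leq_pmull _ M1); lia.
    - by apply: leq_trans (leq_mul HM (leqnn _)); rewrite bD bbb; nia.
    - by apply: leq_trans (leq_mul HM (leqnn _)); rewrite leq_pmulr //; lia.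
  + by [].
Qed.

(** * The delay bound *)

(** One round costs [U ^ 4] by the four nested loops of the body, a descent one factor [U] more, and
    the sizes another. The 6 collects two for the sizes, one and two for the copies of [gap], and
    one for [C]. *)
Lemma delay_bound U C n d tr0 sp w1 w2 W (gap := C * (3 * n + 1)) :
  0 < U -> 3 * n + 1 <= U -> d.+1 <= U ->
  C <= (W + 2) * U ^ 4 -> tr0 <= sp + w1 + w2 * U ^ 2 ->
  tr0 + d.+1 * (gap + C) + gap + (2 * gap + C) + 1 <=
  (sp + w1 + w2 + 6 * (W + 2) + 1) * U ^ 6.
Proof.
move=> U0 Hn Hd HC Ht.
have mono a b c : a <= b -> c * U ^ a <= c * U ^ b.
  by move=> H; rewrite leq_mul2l leq_pexp2l ?orbT.
have G : gap <= (W + 2) * U ^ 5.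
  by rewrite /gap (expnSr U 4) mulnA leq_mul.
have C5 : C <= (W + 2) * U ^ 5 by apply: leq_trans HC _; apply: mono.
have D : d.+1 * (gap + C) <= 2 * ((W + 2) * U ^ 6).
  rewrite (expnS U 5) [_ * (U * _)]mulnCA [2 * _]mulnCA leq_mul //.
  by rewrite mul2n -addnn leq_add.
have G6 := leq_trans G (mono 5 6 (W + 2) isT).
have C6 := leq_trans C5 (mono 5 6 (W + 2) isT).
have T6 : tr0 <= (sp + w1) * U ^ 6 + w2 * U ^ 6.
  apply: leq_trans Ht _; apply: leq_add; last exact: mono.
  by rewrite -{1}(muln1 (sp + w1)) leq_mul2l expn_gt0 U0 orbT.
have U6 : 0 < U ^ 6 by rewrite expn_gt0 U0.
move: (U ^ 6) D G6 C6 T6 U6 => V D G6 C6 T6 U6.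
move: gap D G6 C6 {G C5 HC} => g D G6 C6; nia.
Qed.

Lemma input_size_ge x : size x <= input_size x.
Proof. by rewrite /input_size -sum1_size; apply: leq_sum. Qed.

Lemma tfunE d : tfun d = ((2 * d + 2) ^ d.+1) ^ 6.
Proof. by rewrite /tfun -expnM (mulnC _ 6). Qed.

Lemma exp6_bound Q : exists c, forall L N, L <= N -> 0 < N ->
  Q * (6 * L + 40) ^ 6 <= c * N ^ 6 + c.
Proof.
exists (Q * 46 ^ 6) => L N HL HN; apply: leq_trans (leq_addr _ _).
rewrite -mulnA -expnMn leq_mul2l leq_exp2r //; apply/orP; right; lia.
Qed.

Theorem mainTheorem11 : DelayFPT AllClosestString.
Proof.
pose Q := size pro + cb cInit1 (fun=> 0) + weight cInit2 + 6 * (weight cBody + 2) + 1.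
have [c Hc] := exp6_bound Q.
exists prog, tfun, c, 6; split; first exact: tfun_computable.
move=> x Hx c0 B; rewrite /= in x Hx c0 B *.
set L := size (cs_encode x).
have EL : L = size (cs_strings x) * cs_n x + 3 by apply: size_encode.
have K0 : 0 < size (cs_strings x) by case: Hx.
have nL : cs_n x <= size (cs_strings x) * cs_n x by rewrite leq_pmull.
have [tr0 [m [st [[R0 S0 I0 O0 B0] [[rn rd rk rG] [rD rb rM] [rA rX rY]]]]]] := init_run Hx.
set rho := vs st in I0 B0 rn rd rk rG rD rb rM rA rX rY.
have kn : rho vk * rho vn <= size (cs_strings x) * cs_n x by rewrite rk rn; case: eqP => // ->.
have lay1 : rho vA + rho vk * rho vn <= rho vX by rewrite rA rX leq_add2l -/L; lia.
have lay2 : rho vX + rho vn <= rho vY by rewrite rX rY rn leq_add2l -/L; lia.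
have HD : rho vD = (rho vd).+1 by rewrite rD rd.
have Hb : rho vb = 2 * rho vd + 2 by rewrite rb rd.
have HM : rho vM = rho vb ^ (rho vd).+1 by rewrite rM HD.
have [[_ _ _ code1] code2 code3 Esz] := prog_code.
(* [6 * L + 40] is the address [vY], the largest of the addresses, and [vM] dominates [vb], [vD] and
   [vd]; the product bounds every read-only variable. *)
pose U := rho vM * (6 * L + 40).
have bM : rho vb <= rho vM by rewrite rM -{1}(expn1 (rho vb)) leq_pexp2l //; lia.
have MU : rho vM <= U by rewrite leq_pmulr //; lia.
have M0 : 0 < rho vM by lia.
have LU : 6 * L + 40 <= U by rewrite leq_pmull.
have kU : rho vk <= U by rewrite rk; case: eqP => E0; nia.
have roU v : ro v -> rho v <= U.
  by rewrite /ro; do 10 (case: v => [|v]; first by lia).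
have [C HC] : exists C, C = cb cBody rho + 2 by eexists.
have C4 : C <= (weight cBody + 2) * U ^ 4.
  have U0 : 0 < U by lia.
  have := cb_le wf_body U0 roU; rewrite HC mulnDl => H; apply: leq_add => //.
  by rewrite -{1}(muln1 2) leq_mul2l expn_gt0 U0.
have HCle : cb cBody rho + 2 <= C by rewrite HC.
pose gap := C * (3 * rho vn + 1).
(* The terms are the silence of the initialisation, the silence passed on between sizes with one
   more descent, the requirement [2 * gap + C] of the traversal, and the final exit jump. *)
pose B1 := size tr0 + (rho vd).+1 * (gap + C) + gap + (2 * gap + C) + 1.
have HB1 : 2 * gap + C <= B1 by rewrite /B1; lia.
have [tr1 [m1 [st1 [R1 S1 run0 O1 G1]]]] :=
  @levels rho (bit x) lay1 lay2 HD Hb HM prog ph pend code1 code2 code3 C HCle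
    B1 (rho vd).+1 0 m st HB1 erefl S0 I0.
have R2 := step_exit S1 run0.
have RT := run_cat R0 (run_cat R1 R2).
have Hend : step prog (Config pend m1 [::]) = None by apply: step_end; rewrite Esz.
have [HT OT] := run_halts RT Hend.
have [_ OA] := run_exec RT.
exists (size (tr0 ++ tr1 ++ [:: None])); split=> //.
have EO : outputs prog c0 (size (tr0 ++ tr1 ++ [:: None])) = outs_of rho (bit x).
  by rewrite OT !pmap_cat O0 O1 /= cats0.
rewrite /= EO; have [o1 o2 _] := outs_sorted rho (bit x) (rho vd).+1 0.
split; first exact: o1.
split; first by move=> S; apply: cs_solutionP.
split.
  move=> i j Hi Hj Hs; rewrite ltnNge; apply/negP; rewrite leq_eqVlt => /orP[/eqP E|Hji].
    by rewrite E ltnn in Hs.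
  have := pairwiseP [::] o2 j i Hj Hi Hji; by rewrite leqNgt Hs.
move=> a b ab bT Hn.
have B1B : B1 <= B.
  apply: (@leq_trans (Q * U ^ 6)).
    apply: delay_bound => //; try lia.
  (* [U ^ 6] splits into [vM ^ 6], which is [tfun] at the parameter, and a polynomial in the input
     length. *)
  rewrite /U expnMn mulnCA /B tfunE -rd -Hb -HM leq_mul2l; apply/orP; right.
  apply: Hc; first exact: input_size_ge.
  by apply: leq_trans (input_size_ge _); rewrite -/L; lia.
apply: leq_trans B1B.
have Gok : gok B1 0 (tr0 ++ tr1 ++ [:: None]).
  rewrite !gok_cat gok_size /=; last by rewrite /B1; lia.
  have F0 := gfin_size 0 tr0; rewrite add0n in F0.
  have [g1 g2] := G1 (gfin 0 tr0) ltac:(rewrite /B1 /gap in F0 *; lia).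
  by rewrite g1 andbT /=; apply: leq_ltn_trans g2 _; rewrite /B1 -/gap; lia.
have [] // := gok_gap Gok (leq0n _) ab bT.
move=> i ai ib; have [<- _] := OA i (leq_trans ib bT); exact: Hn.
Qed.
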